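(* Let $R,P>0$ and let $v_1,v_2,v_3,v_4>0$ satisfy $v_1>v_2$, $v_2<v_3$, $v_3>v_4$, $v_4<v_1$. For $\lambda\in\mathbb{C}$ and $i=1,2,3,4$ set $$F_i(\lambda)=\begin{pmatrix}-\dfrac{\lambda+P^2R}{v_i}&\dfrac{RP}{v_i}\\[2mm]-RP&\lambda+R\end{pmatrix},\qquad C(\lambda)=e^{F_1(\lambda)}\begin{pmatrix}v_4/v_1&0\\0&1\end{pmatrix}e^{F_4(\lambda)}e^{F_3(\lambda)}\begin{pmatrix}v_2/v_3&0\\0&1\end{pmatrix}e^{F_2(\lambda)},$$ and $\Delta(\lambda):=-\det(C(\lambda)-\mathrm{Id})=\operatorname{trace}(C(\lambda))-\det(C(\lambda))-1$. Then, for every $\lambda\in\mathbb{C}$, $\lambda$ is an eigenvalue of the operator $A$ defined in the context if and only if $1$ is an eigenvalue of the $2\times2$ matrix $C(\lambda)$; equivalently, if and only if $\Delta(\lambda)=0$.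
   Context: Let $x_i=-3+i$ for $i=1,\dots,5$ and $I_i=(x_i,x_{i+1})$ for $i=1,2,3,4$, so $I_1=(-2,-1)$, $I_2=(-1,0)$, $I_3=(0,1)$, $I_4=(1,2)$. Let $X=L^2(-2,2)\times L^2(-2,2)$ (complex valued). The unbounded linear operator $A:D(A)\subset X\to X$ is defined on each interval $I_i$ by $$A\begin{pmatrix}c\\ q\end{pmatrix}=\begin{pmatrix}-v_ic_x-RP^2c+RPq\\ q_x+RPc-Rq\end{pmatrix}\quad\text{on } I_i,\ i=1,2,3,4,$$ and $D(A)$ is the set of $(c,q)^T\in\prod_{i=1}^4H^1(I_i)\times\prod_{i=1}^4H^1(I_i)$ satisfying $c(-1^-)=c(-1^+)$, $c(1^-)=c(1^+)$, $v_1c(-2^+)=v_4c(2^-)$, $v_3c(0^+)=v_2c(0^-)$, and $q(x_0^-)=q(x_0^+)$ for $x_0=-1,0,1$ together with $q(-2^+)=q(2^-)$. An eigenvalue of $A$ is a $\lambda\in\mathbb{C}$ for which there is a nonzero $(c,q)^T\in D(A)$ with $A(c,q)^T=\lambda(c,q)^T$. *)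

(* Defs.v *)
From HB Require Import structures.
From mathcomp Require Import all_boot all_order all_algebra.
From mathcomp Require Import complex.
From mathcomp Require Import all_classical all_reals all_analysis.

Set Implicit Arguments.
Unset Strict Implicit.
Unset Printing Implicit Defensive.

Import Order.TTheory GRing.Theory Num.Theory numFieldNormedType.Exports.
Local Open Scope complex_scope.
Local Open Scope classical_set_scope.
Local Open Scope ring_scope.

(* Elements of L^2 and H^1 are represented by functions [K -> K[i]] on the
   whole line, of which only the a.e. class on the relevant interval matters. *)

Section FunctionSpaces.
Variable K : realType.
Local Notation mu := (@lebesgue_measure K).

Definition L2 (D : set K) (f : K -> K[i]) : Prop :=
  [/\ measurable_fun D (fun x => complex.Re (f x)),
      measurable_fun D (fun x => complex.Im (f x)) &
      (\int[mu]_(x in D) (complex.Re (f x) ^+ 2 + complex.Im (f x) ^+ 2)%:E < +oo)%E].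

Definition cintegral (D : set K) (f : K -> K[i]) : K[i] :=
  (\int[mu]_(x in D) complex.Re (f x)) +i* (\int[mu]_(x in D) complex.Im (f x)).

(* C^1 functions with compact support in (a, b), as in Brezis' definition of
   H^1(a, b); real test functions suffice since complex ones are linear
   combinations of these. *)
Definition test_function (a b : K) (phi : K -> K) : Prop :=
  [/\ forall x, derivable phi x 1,
      continuous (derive1 phi),
      compact (closure [set x | phi x != 0]) &
      closure [set x | phi x != 0] `<=` `]a, b[].

Definition weak_derivative (a b : K) (u g : K -> K[i]) : Prop :=
  forall phi, test_function a b phi ->
    cintegral `]a, b[ (fun x => u x * (derive1 phi x)%:C) =
    - cintegral `]a, b[ (fun x => g x * (phi x)%:C).

Definition H1 (a b : K) (u : K -> K[i]) : Prop :=
  L2 `]a, b[ u /\ exists2 g, L2 `]a, b[ g & weak_derivative a b u g.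

(* A representative of the weak derivative of [u \in H1 a b] (unique a.e.) *)
Definition wderiv (a b : K) (u : K -> K[i]) : K -> K[i] :=
  xget (cst 0) [set g | L2 `]a, b[ g /\ weak_derivative a b u g].

(* The representative of [u \in H1 a b] that is continuous on [a, b]; its
   values at a and b are the one-sided values u(a^+) and u(b^-).
   [K[i]^o] is K[i] with the topology of its norm. *)
Definition continuous_rep (a b : K) (u : K -> K[i]) : K -> K[i] :=
  xget u [set w | {within `[a, b], continuous (w : K -> K[i]^o)} /\
                  (w = u %[ae mu in [set` `]a, b[]])].

(* Equality in L^2(a, b) x L^2(a, b). *)
Definition eqL2xL2 (a b : K) (u w : (K -> K[i]) * (K -> K[i])) : Prop :=
  (u.1 = w.1 %[ae mu in [set` `]a, b[]]) /\
  (u.2 = w.2 %[ae mu in [set` `]a, b[]]).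

End FunctionSpaces.

(* The velocities are a sequence [v : nat -> K] of which only the entries
   v 1, v 2, v 3, v 4 are used. *)

Section Operator.
Variables (K : realType) (v : nat -> K) (R P : K).

Local Notation space := ((K -> K[i]) * (K -> K[i]))%type.

Definition node (i : nat) : K := - 3 + i%:R.

(* u(x_i^+), computed on I_i *)
Definition left_value (i : nat) (u : K -> K[i]) : K[i] :=
  continuous_rep (node i) (node i.+1) u (node i).

(* u(x_{i+1}^-), computed on I_i *)
Definition right_value (i : nat) (u : K -> K[i]) : K[i] :=
  continuous_rep (node i) (node i.+1) u (node i.+1).

Definition domA (u : space) : Prop :=
  let: (c, q) := u in
  [/\ forall i, (1 <= i <= 4)%N ->
        H1 (node i) (node i.+1) c /\ H1 (node i) (node i.+1) q,
      [/\ right_value 1 c = left_value 2 c,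
          right_value 3 c = left_value 4 c,
          (v 1%N)%:C * left_value 1 c = (v 4%N)%:C * right_value 4 c &
          (v 3%N)%:C * left_value 3 c = (v 2%N)%:C * right_value 2 c] &
      [/\ right_value 1 q = left_value 2 q,
          right_value 2 q = left_value 3 q,
          right_value 3 q = left_value 4 q &
          left_value 1 q = right_value 4 q]].

(* The function equal to [F i] on I_i (and to 0 off these intervals). *)
Definition piecewise (F : nat -> K -> K[i]) (x : K) : K[i] :=
  \sum_(1 <= i < 5 | x \in `]node i, node i.+1[) F i x.

Definition opA (u : space) : space :=
  let: (c, q) := u in
  (piecewise (fun i x =>
     - (v i)%:C * wderiv (node i) (node i.+1) c x
     - (R * P ^+ 2)%:C * c x + (R * P)%:C * q x),
   piecewise (fun i x =>
     wderiv (node i) (node i.+1) q x + (R * P)%:C * c x - R%:C * q x)).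

Definition eigenvalueA (lam : K[i]) : Prop :=
  exists u : space,
    [/\ domA u,
        ~ eqL2xL2 (- 2) 2 u (cst 0, cst 0) &
        eqL2xL2 (- 2) 2 (opA u)
          (fun x => lam * u.1 x, fun x => lam * u.2 x)].

Definition mx2 (a b c d : K[i]) : 'M[K[i]]_2 :=
  \matrix_(i, j) if i == 0 then if j == 0 then a else b
                 else if j == 0 then c else d.

Definition expmx (M : 'M[K[i]]_2) : 'M[K[i]]_2 :=
  lim ((\sum_(k < n) (k`!%:R)^-1 *: M ^+ k : 'M[K[i]^o]_2) @[n --> \oo]).

Definition Fmx (i : nat) (lam : K[i]) : 'M[K[i]]_2 :=
  mx2 (- ((lam + (P ^+ 2 * R)%:C) / (v i)%:C)) ((R * P) / v i)%:C
      (- (R * P)%:C)                           (lam + R%:C).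

Definition Cmx (lam : K[i]) : 'M[K[i]]_2 :=
  expmx (Fmx 1 lam) *m mx2 (v 4%N / v 1%N)%:C 0 0 1 *m
  expmx (Fmx 4 lam) *m expmx (Fmx 3 lam) *m
  mx2 (v 2%N / v 3%N)%:C 0 0 1 *m expmx (Fmx 2 lam).

Definition Delta (lam : K[i]) : K[i] := - \det (Cmx lam - 1%:M).

End Operator.

(* Main.v *)
Require Import Defs.
From mathcomp Require Import all_boot all_order all_algebra.
From mathcomp Require Import complex ring lra.
From mathcomp Require Import all_classical all_reals all_analysis measurable_realfun.

(* On each I_i a weak solution y of y' = F_i y is y(x) = e^{(x - x_i) F_i} z_i
   almost everywhere: e^{-(x - x_i) F_i} y has weak derivative 0, hence is
   constant by du Bois-Reymond's lemma. The one-sided values at the two ends of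
   I_i are thus z_i and e^{F_i} z_i, and the transmission conditions chain
   these values into C(lambda) z_2 = z_2, with z_2 = 0 iff y = 0. Conversely a
   fixed vector z_2 of C(lambda) determines z_3, z_4, z_1 and an eigenfunction;
   there the fundamental lemma of the calculus of variations identifies the
   weak derivative picked by [wderiv] with the classical one. *)

Set Implicit Arguments.
Unset Strict Implicit.
Unset Printing Implicit Defensive.

Import Order.TTheory GRing.Theory Num.Theory numFieldNormedType.Exports.
Local Open Scope classical_set_scope.
Local Open Scope complex_scope.
Local Open Scope ring_scope.

(** * The fundamental lemma and du Bois-Reymond's lemma *)

(** The functions [wderiv] and [continuous_rep] are picked by [xget], so nothing is known of them
    beyond their defining properties. Every value therefore has to come from a uniqueness statement:
    weak derivatives agree almost everywhere, and continuous representatives agree on the closed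
    interval, end points included. Instead of mollifiers, one explicit family of C^1 cut-offs serves
    both variational lemmas. Their derivatives are closed formulas, and they tend boundedly to
    indicators of intervals. The transmission conditions join the ends -2 and 2, so the four
    intervals form a loop and C(lambda) is its monodromy matrix. The loop is cut at the node -1,
    where both components are continuous, so that no jump matrix stands at the cut. This is why the
    fixed vector is z_2. *)

Section FundamentalLemma.
Variable K : realType.
Local Notation mu := (@lebesgue_measure K).
Implicit Types (a b s t x y : K) (f phi : K -> K).

Lemma test_function_intro a b s t phi phi' :
  a < s -> t < b -> (forall x, is_derive x 1 phi (phi' x)) ->
  continuous phi' -> (forall x, x \notin `[s, t] -> phi x = 0) ->
  test_function a b phi.
Proof.
move=> as_ tb dphi cphi' phi0.
have sub : closure [set x | phi x != 0] `<=` `[s, t].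
  rewrite [X in _ `<=` X](_ : _ = closure `[s, t]); last exact/closure_id/interval_closed.
  by apply: closureS => x /= /negP h; apply: contrapT => /negP /phi0 /eqP.
split.
- by move=> x; have [] := dphi x.
- rewrite (_ : derive1 phi = phi') //; apply/funext => x.
  by rewrite derive1E; have [] := dphi x.
- exact: (subclosed_compact (@closed_closure _ _) (@segment_compact _ s t)).
- move=> x /sub /=; rewrite !in_itv /= => /andP[sx xt].
  by rewrite (lt_le_trans as_) // (le_lt_trans xt).
Qed.

(** * Explicit C^1 cut-offs of intervals *)

Lemma is_derive_sqr_bound f x l :
  (forall h, `|f (x + h) - f x - l * h| <= h ^+ 2) -> is_derive x 1 f l.
Proof.
move=> fl.
have cv : h^-1 *: ((f \o shift x) (h *: 1) - f x) @[h --> 0^'] --> l.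
  apply/cvgrPdist_le => e e0; near=> h.
  have h0 : h != 0 by near: h; exact: nbhs_dnbhs_neq.
  have hp : 0 < `|h| by rewrite normr_gt0.
  have -> : l - h^-1 *: ((f \o shift x) (h *: 1) - f x) =
            - (h^-1 * (f (x + h) - f x - l * h)).
    by rewrite /= /GRing.scale /= mulr1 [h + x]addrC; field.
  rewrite normrN normrM normfV ler_pdivrMl //; apply: le_trans (fl h) _.
  rewrite -real_normK ?num_real // expr2 ler_pM2l //.
  near: h; apply: dnbhs0_le => //.
split; first by apply/cvg_ex; exists l.
exact: cvg_lim cv.
Unshelve. all: by end_near.
Qed.

Lemma is_derive_sqpos x :
  is_derive x 1 (fun y : K => Num.max 0 y ^+ 2) (2 * Num.max 0 x).
Proof.
apply: is_derive_sqr_bound => h.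
have [x0|x0] := leP 0 x; have [xh0|xh0] := leP 0 (x + h); rewrite ler_norml; nra.
Qed.

(** Squaring the positive part of the parabola makes it C^1 across its zeros [s] and [t]. *)
Definition hump s t x : K := Num.max 0 ((x - s) * (t - x)) ^+ 2.

(** With h the hump, this is n h / (1 + n h): it vanishes with h, tends to 1 where h > 0, and stays
    between 0 and 1. *)
Definition cutoff s t (n : nat) x : K := 1 - (1 + n%:R * hump s t x)^-1.

Lemma hump_ge0 s t x : 0 <= hump s t x.
Proof. exact: sqr_ge0. Qed.

Lemma hump_eq0 s t x : x \notin `]s, t[ -> s <= t -> hump s t x = 0.
Proof.
rewrite in_itv /= negb_and -!leNgt => + st.
by rewrite /hump => h; rewrite max_l ?expr0n //; case/orP: h => h; nra.
Qed.

Lemma hump_gt0 s t x : x \in `]s, t[ -> 0 < hump s t x.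
Proof.
rewrite in_itv /= => /andP[sx xt].
by rewrite exprn_gt0 // lt_max mulr_gt0 ?orbT // subr_gt0.
Qed.

Lemma is_derive_hump s t x :
  is_derive x 1 (hump s t) (2 * Num.max 0 ((x - s) * (t - x)) * (s + t - 2 * x)).
Proof.
have d : is_derive x 1 ((id - cst s) * (cst t - id) : K -> K) (s + t - 2 * x).
  by apply: is_derive_eq; rewrite /GRing.scale /= !fctE /=; ring.
exact: (@is_derive1_comp _ (fun y => Num.max 0 y ^+ 2) _ _ _ _ (is_derive_sqpos _) d).
Qed.

Lemma cutoff_den_gt0 s t n x : 0 < 1 + n%:R * hump s t x.
Proof. by rewrite ltr_pwDl // mulr_ge0 // hump_ge0. Qed.

Lemma test_function_cutoff a b s t n : a < s -> s <= t -> t < b ->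
  test_function a b (cutoff s t n).
Proof.
move=> as_ st tb.
have cb : continuous (hump s t).
  move=> x; apply/differentiable_continuous/derivable1_diffP.
  by have [] := is_derive_hump s t x.
apply: (@test_function_intro a b s t _ (fun x => (1 + n%:R * hump s t x) ^- 2 *
  (n%:R * (2 * Num.max 0 ((x - s) * (t - x)) * (s + t - 2 * x))))) => //.
- move=> x; have db := is_derive_hump s t x.
  have d : is_derive x 1 (cst 1 + n%:R \*: hump s t)
    (n%:R * (2 * Num.max 0 ((x - s) * (t - x)) * (s + t - 2 * x))).
    by apply: is_derive_eq; rewrite /GRing.scale /= add0r.
  have := is_deriveV _ d; rewrite fctE /= => /(_ (lt0r_neq0 (cutoff_den_gt0 s t n x))) d'.
  rewrite (_ : cutoff s t n = cst 1 - (fun y => (1 + n%:R * hump s t y)^-1)) //.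
  by apply: is_derive_eq; rewrite sub0r -mulNr opprK.
- move=> x; apply: cvgM.
    apply: cvgV; first by rewrite expf_neq0 ?lt0r_neq0 ?cutoff_den_gt0.
    apply: (@continuous_comp _ _ _ (fun x => 1 + n%:R * hump s t x) (fun y => y ^+ 2));
      last exact: exprn_continuous.
    apply: cvgD; [exact: cvg_cst|apply: cvgM; [exact: cvg_cst|exact: cb]].
  apply: cvgM; [exact: cvg_cst|].
  apply: cvgM; last by apply: cvgB; [exact: cvg_cst|apply: cvgM; [exact: cvg_cst|exact: cvg_id]].
  apply: cvgM; [exact: cvg_cst|].
  apply: (@continuous_comp _ _ _ (fun x => (x - s) * (t - x)) (Num.max 0)) => /=.
    by apply: cvgM; apply: cvgB; solve [exact: cvg_cst|exact: cvg_id].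
  by apply: continuous_max; [exact: cvg_cst|exact: cvg_id].
- move=> x xst; rewrite /cutoff hump_eq0 ?mulr0 ?addr0 ?invr1 ?subrr //.
  by apply: contra xst; exact: subset_itv_oo_cc.
Qed.

Lemma cutoff_cvg s t x : s <= t -> cutoff s t n x @[n --> \oo] --> (\1_`]s, t[ x : K).
Proof.
move=> st; rewrite indicE; have [xst|xst] := boolP (x \in `]s, t[).
  have b0 := hump_gt0 xst; rewrite mem_set //=.
  apply/cvgrPdist_le => e e0; near=> n.
  rewrite /cutoff opprB addrC subrK normfV gtr0_norm ?cutoff_den_gt0 //.
  rewrite invf_ple ?posrE ?cutoff_den_gt0 // ler_wpDl // -ler_pdivrMr //.
  by near: n; exact: nbhs_infty_ger.
rewrite memNset /=; last exact/negP.
rewrite /cutoff hump_eq0 //.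
under eq_fun do rewrite mulr0 addr0 invr1 subrr.
exact: cvg_cst.
Unshelve. all: by end_near.
Qed.

Lemma cutoff_bounds s t n x : 0 <= cutoff s t n x <= 1.
Proof.
have h := cutoff_den_gt0 s t n x.
rewrite /cutoff subr_ge0 invf_le1 // lerDl mulr_ge0 ?hump_ge0 //=.
by rewrite gerBl invr_ge0 ltW.
Qed.

(** The cut-offs converge to the indicator of []s, t[] with values in [0, 1], so dominated
    convergence with majorant |f| carries the vanishing integrals over to the limit. *)
Lemma integral_itv_eq0 a b s t f :
  mu.-integrable `]a, b[ (EFin \o f) ->
  (forall s t n, a < s -> s <= t -> t < b ->
    \int[mu]_(x in `]a, b[) (f x * cutoff s t n x) = 0) ->
  a < s -> s <= t -> t < b -> \int[mu]_(x in `]s, t[) f x = 0.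
Proof.
move=> fi f0 as_ st tb.
have mf : measurable_fun `]a, b[ f by apply/measurable_EFinP; exact: measurable_int fi.
have mc n : measurable_fun `]a, b[ (cutoff s t n).
  apply: measurable_funTS; apply: continuous_measurable_fun => x.
  apply/differentiable_continuous/derivable1_diffP.
  by have [] := @test_function_cutoff a b s t n as_ st tb.
have [] := @dominated_convergence _ _ _ mu `]a, b[ _
  (fun n x => (f x * cutoff s t n x)%:E) (fun x => (f x * \1_`]s, t[ x)%:E)
  (EFin \o (Num.norm \o f)).
- exact: measurable_itv.
- by move=> n; apply/measurable_EFinP; apply: measurable_funM; [exact: mf|exact: mc].
- apply/measurable_EFinP; apply: measurable_funM; first exact: mf.
  exact: measurable_indic.
- apply: aeW => x _; apply: cvg_EFin; first by near=> n.
  by apply: cvgM; [exact: cvg_cst|exact: cutoff_cvg].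
- exact: integrable_norm.
- apply: aeW => x n _ /=; rewrite lee_fin normrM ler_piMr //.
  by have /andP[c0 c1] := cutoff_bounds s t n x; rewrite ger0_norm.
move=> fli _ cv.
have sub : `]s, t[ `<=` `]a, b[ by apply: subset_itvW; exact: ltW.
have -> : \int[mu]_(x in `]s, t[) f x = fine (\int[mu]_(x in `]a, b[) (f x * \1_`]s, t[ x)%:E).
  rewrite -[RHS]/(Rintegral mu `]a, b[ _) -[in LHS](setIidr sub) Rintegral_mkcondr.
  apply: eq_Rintegral => x _; rewrite patchE indicE.
  by case: ifP => _; rewrite ?mulr1 ?mulr0.
suff -> : (\int[mu]_(x in `]a, b[) (f x * \1_`]s, t[ x)%:E)%E = 0%E by [].
rewrite -(cvg_lim _ cv) //; apply: cvg_lim => //.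
rewrite [X in X @ _ --> _](_ : _ = cst 0%E); first exact: cvg_cst.
apply/funext => n /=; rewrite -[LHS]fineK; first by congr (_%:E); exact: f0.
apply: integrable_fin_num => //; apply: (le_integrable _ _ _ fi) => //.
- by apply/measurable_EFinP; apply: measurable_funM; [exact: mf|exact: mc].
- move=> x _ /=; rewrite lee_fin normrM ler_piMr //.
  by have /andP[c0 c1] := cutoff_bounds s t n x; rewrite ger0_norm.
Unshelve. all: by end_near.
Qed.

(* Only the cut-offs are tested, so that this also applies in [du_bois_reymond],
   where the support of the test function has to be an explicit interval. *)
Lemma ae0_cutoff a b f :
  mu.-integrable `]a, b[ (EFin \o f) ->
  (forall s t n, a < s -> s <= t -> t < b ->
    \int[mu]_(x in `]a, b[) (f x * cutoff s t n x) = 0) ->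
  f = cst 0 %[ae mu in [set` `]a, b[]].
Proof.
move=> fi f0.
have fi' : mu.-integrable setT (EFin \o (f \_ `]a, b[)).
  by rewrite -restrict_EFin; apply: (integrable_mkcond _ _).1.
(* Lebesgue's form of the fundamental theorem: the indefinite integral [F] of [f] extended by 0 has
   derivative [f] almost everywhere. Since [F] is constant on []a, b[], that derivative is 0. *)
have := @FTC1 K (f \_ `]a, b[) (BRight a) _ (integrable_locally _ fi).
have h y : mu.-integrable [set` Interval (BRight a) (BRight y)] (EFin \o (f \_ `]a, b[)).
  exact: integrableS fi'.
move=> /(_ h) /=; set F := fun x => \int[mu]_(t in `]a, x]) _.
have F0 x y : a < x -> x <= y -> y < b -> F y = F x.
  move=> ax xy yb; apply/eqP; rewrite -subr_eq0; apply/eqP.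
  rewrite /F Rintegral_itvB ?bnd_simp //; last exact: ltW.
  rewrite -Rintegral_itv_bndo_bndc; last exact: integrableS fi'.
  rewrite -[RHS](integral_itv_eq0 fi f0 ax xy yb); apply: eq_Rintegral => z.
  rewrite inE /= in_itv /= => /andP[xz zy]; rewrite patchE mem_set //= in_itv /=.
  by rewrite (lt_trans ax) // (lt_trans zy).
move=> /(_ (measurable_itv _)); apply: filterS; first exact: (ae_filter_ringOfSetsType mu).
move=> x H /=; rewrite in_itv /= => /andP[ax xb].
have [|_] := H _; first by rewrite lte_fin.
  rewrite patchE mem_set /= ?in_itv /= ?ax // => <-.
rewrite derive1E (@near_eq_derive _ _ _ F (cst (F x))) ?derive_cst //.
near=> y; have ay : a < y by near: y; exact: lt_nbhsr.
have yb : y < b by near: y; exact: lt_nbhsl.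
by have [xy|/ltW yx] := leP x y; [|symmetry]; exact: F0.
Unshelve. all: by end_near.
Qed.

Lemma continuous_cutoff s t n : s <= t -> continuous (cutoff s t n).
Proof.
move=> st x; apply/differentiable_continuous/derivable1_diffP.
have s1 : s - 1 < s by rewrite ltrBlDr ltrDl.
have t1 : t < t + 1 by rewrite ltrDl.
by have [+ _ _ _] := test_function_cutoff n s1 st t1; exact.
Qed.

Lemma fundamental_lemma a b f :
  mu.-integrable `]a, b[ (EFin \o f) ->
  (forall phi, test_function a b phi -> \int[mu]_(x in `]a, b[) (f x * phi x) = 0) ->
  f = cst 0 %[ae mu in [set` `]a, b[]].
Proof.
move=> fi f0; apply: ae0_cutoff => // s t n as_ st tb.
exact/f0/test_function_cutoff.
Qed.

Lemma integrable_continuous_support s t f : continuous f ->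
  (forall x, x \notin `]s, t[ -> f x = 0) -> mu.-integrable setT (EFin \o f).
Proof.
move=> cf f0; have -> : f = f \_ `[s, t].
  apply/funext => x; rewrite patchE; case: ifPn => //; rewrite notin_setE /= => xst.
  by apply/f0/negP => /subset_itv_oo_cc.
rewrite -restrict_EFin; apply: (integrable_mkcond _ _).1 => //.
apply: continuous_compact_integrable; first exact: segment_compact.
exact: continuous_subspaceT.
Qed.

(** Integrating from -oo lets primitives of functions with different supports be combined: each
    vanishes far to the left and equals the total integral far to the right. *)
Definition primitive f x : K := \int[mu]_(t in `]-oo, x]) f t.

Section Primitive.
Variables (s t : K) (f : K -> K).
Hypotheses (st : s <= t) (cf : continuous f) (f0 : forall x, x \notin `]s, t[ -> f x = 0).

Lemma is_derive_primitive x : is_derive x 1 (primitive f) (f x).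
Proof.
have xx : x < x + 1 by rewrite ltrDl.
have [|||d e] := @continuous_FTC1 K f -oo%O x (x + 1) xx => //.
- exact: integrableS (integrable_continuous_support cf f0).
- exact: ltNyr.
- exact: cf.
by split=> //; rewrite -derive1E.
Qed.

Lemma primitive_le x : x <= s -> primitive f x = 0.
Proof.
move=> xs; rewrite /primitive (@eq_Rintegral _ _ _ _ _ (cst 0)).
  by rewrite Rintegral_cst // mul0r.
move=> y; rewrite inE /= in_itv /= => yx; apply: f0.
by rewrite in_itv /= negb_and -leNgt (le_trans yx).
Qed.

Lemma primitive_ge x : t <= x -> primitive f x = \int[mu]_y f y.
Proof.
move=> tx; rewrite /primitive [RHS]Rintegral_mkcond [LHS]Rintegral_mkcond.
apply: eq_Rintegral => y _; rewrite patch_setT patchE; case: ifPn => //.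
rewrite notin_setE /= in_itv /= => /negP; rewrite -ltNge => xy; apply/esym/f0.
by rewrite in_itv /= negb_and -!leNgt (le_trans tx (ltW xy)) orbT.
Qed.

End Primitive.

(** A combination of two cut-offs whose integrals cancel is the derivative of a test function. Hence
    the integral of [f] against a cut-off is proportional to the integral of the cut-off, and the
    ratio is the constant. *)
Lemma du_bois_reymond a b f :
  mu.-integrable `]a, b[ (EFin \o f) ->
  (forall phi, test_function a b phi ->
    \int[mu]_(x in `]a, b[) (f x * derive1 phi x) = 0) ->
  exists m, f = cst m %[ae mu in [set` `]a, b[]].
Proof.
move=> fi f0.
have cutoff0 s t n x : s <= t -> x \notin `]s, t[ -> cutoff s t n x = 0.
  by move=> st xst; rewrite /cutoff hump_eq0 // mulr0 addr0 invr1 subrr.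
have fci s t n : s <= t -> mu.-integrable `]a, b[ (EFin \o (fun x => f x * cutoff s t n x)).
  move=> st; apply: (le_integrable _ _ _ fi) => //.
    apply/measurable_EFinP; apply: measurable_funM.
      by apply/measurable_EFinP; exact: measurable_int fi.
    by apply: measurable_funTS; apply: continuous_measurable_fun; exact: continuous_cutoff.
  move=> x _ /=; rewrite lee_fin normrM ler_piMr //.
  by have /andP[c0 c1] := cutoff_bounds s t n x; rewrite ger0_norm.
have ci s t n : s <= t -> mu.-integrable `]a, b[ (EFin \o cutoff s t n).
  move=> st; have h x := @cutoff0 s t n x st.
  exact: integrableS (integrable_continuous_support (@continuous_cutoff s t n st) h).
pose I s t n := \int[mu]_x cutoff s t n x.
have IE s t n : a < s -> s <= t -> t < b -> \int[mu]_(x in `]a, b[) cutoff s t n x = I s t n.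
  move=> as_ st tb; rewrite Rintegral_mkcond; apply: eq_Rintegral => x _.
  rewrite patchE; case: ifPn => //; rewrite notin_setE /= => /negP xab.
  by apply/esym/cutoff0 => //; apply: contra xab; apply: subset_itvW; exact: ltW.
have key s0 t0 n0 s t n : a < s0 -> s0 <= t0 -> t0 < b -> a < s -> s <= t -> t < b ->
    I s0 t0 n0 * \int[mu]_(x in `]a, b[) (f x * cutoff s t n x) =
    I s t n * \int[mu]_(x in `]a, b[) (f x * cutoff s0 t0 n0 x).
  move=> as0 st0 tb0 as_ st tb.
  (* The weights make the total integrals cancel, so that [phi] vanishes to the right of both
     supports as well as to the left. *)
  pose phi := I s0 t0 n0 \*: primitive (cutoff s t n) - I s t n \*: primitive (cutoff s0 t0 n0).
  have d x : is_derive x 1 phi (I s0 t0 n0 * cutoff s t n x - I s t n * cutoff s0 t0 n0 x).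
    have d1 := is_derive_primitive (@continuous_cutoff s t n st) (fun x => @cutoff0 s t n x st) x.
    have d2 := is_derive_primitive (@continuous_cutoff s0 t0 n0 st0)
      (fun x => @cutoff0 s0 t0 n0 x st0) x.
    by rewrite /phi; exact: is_deriveB.
  have tf : test_function a b phi.
    apply: (@test_function_intro a b (Num.min s s0) (Num.max t t0) _ _ _ _ d).
    - by rewrite lt_min as_.
    - by rewrite gt_max tb.
    - move=> x; apply: cvgB; (apply: cvgM; [exact: cvg_cst|exact: continuous_cutoff]).
    - move=> x; rewrite in_itv /= negb_and -!ltNge lt_min gt_max.
      rewrite /phi !fctE /GRing.scale /= => /orP[/andP[xs xs0]|/andP[xt xt0]].
        rewrite (primitive_le (fun x => @cutoff0 s t n x st)) ?ltW //.
        by rewrite (primitive_le (fun x => @cutoff0 s0 t0 n0 x st0)) ?ltW // !scaler0 subrr.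
      rewrite (primitive_ge (fun x => @cutoff0 s t n x st)) ?ltW //.
      rewrite (primitive_ge (fun x => @cutoff0 s0 t0 n0 x st0)) ?ltW //.
      by rewrite /GRing.scale /= mulrC subrr.
  apply/eqP; rewrite -subr_eq0 -[X in _ == X](f0 _ tf) -!RintegralZl ?fci //.
  rewrite -RintegralB //; try by apply: (integrableZl _ (_ : K) (fci _ _ _ _)).
  apply/eqP/eq_Rintegral => x _; rewrite derive1E; have [_ ->] := d x; ring.
have cst_int c : mu.-integrable `]a, b[ (EFin \o cst c).
  apply: integrableS (_ : mu.-integrable `[a, b] _) => //; first exact: subset_itv_oo_cc.
  apply: continuous_compact_integrable; first exact: segment_compact.
  by apply: continuous_subspaceT => x; exact: cvg_cst.
have [[[[s0 t0] n0] /= [as0 st0 tb0 I0]]|I0] := pselect (exists p : K * K * nat,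
  [/\ a < p.1.1, p.1.1 <= p.1.2, p.1.2 < b & I p.1.1 p.1.2 p.2 != 0]).
  pose m := (\int[mu]_(x in `]a, b[) (f x * cutoff s0 t0 n0 x)) / I s0 t0 n0.
  exists m; suff : (f \- cst m) = cst 0 %[ae mu in [set` `]a, b[]].
    apply: filterS; first exact: (ae_filter_ringOfSetsType mu).
    by move=> x h /h /eqP; rewrite subr_eq0 => /eqP.
  apply: ae0_cutoff.
    by rewrite /comp /=; apply: (integrableB _ fi (cst_int m)).
  move=> s t n as_ st tb.
  under eq_Rintegral do rewrite /= mulrBl.
  rewrite RintegralB ?fci //; last exact: (integrableZl _ m (ci _ _ _ _)).
  rewrite RintegralZl ?ci // IE //; apply: (mulfI I0).
  by rewrite mulr0 mulrBr key // mulrCA mulrA divfK // mulrC subrr.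
(* If all cut-offs have integral 0, [ae0_cutoff] applied to 1 gives 1 = 0
   a.e. on ]a, b[, so that any constant will do. *)
exists 0; have : cst (1 : K) = cst 0 %[ae mu in [set` `]a, b[]].
  apply: ae0_cutoff => // s t n as_ st tb.
  under eq_Rintegral do rewrite mul1r.
  rewrite IE //; apply/eqP/negP => /negP h.
  by apply: I0; exists (s, t, n).
apply: filterS; first exact: (ae_filter_ringOfSetsType mu).
by move=> x h /h /eqP; rewrite oner_eq0.
Qed.

End FundamentalLemma.

(** * Weak derivatives of complex-valued functions *)

Section ComplexCalculus.
Variable K : realType.
Local Notation mu := (@lebesgue_measure K).
Local Notation Re := (@complex.Re K).
Local Notation Im := (@complex.Im K).
Implicit Types (a b x : K) (u g e : K -> K[i]) (phi : K -> K).

Lemma ae_mono (P Q : K -> Prop) : (forall x, P x -> Q x) ->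
  {ae mu, forall x, P x} -> {ae mu, forall x, Q x}.
Proof. by apply: filterS; exact: (ae_filter_ringOfSetsType mu). Qed.

Lemma ae_mono2 (P Q S : K -> Prop) : (forall x, P x -> Q x -> S x) ->
  {ae mu, forall x, P x} -> {ae mu, forall x, Q x} -> {ae mu, forall x, S x}.
Proof. by apply: filterS2; exact: (ae_filter_ringOfSetsType mu). Qed.

Lemma cReM (z w : K[i]) : Re (z * w) = Re z * Re w - Im z * Im w.
Proof. by case: z w => [? ?] [? ?]. Qed.

Lemma cImM (z w : K[i]) : Im (z * w) = Re z * Im w + Im z * Re w.
Proof. by case: z w => [? ?] [? ?]. Qed.

Lemma cReD (z w : K[i]) : Re (z + w) = Re z + Re w.
Proof. by case: z w => [? ?] [? ?]. Qed.

Lemma cImD (z w : K[i]) : Im (z + w) = Im z + Im w.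
Proof. by case: z w => [? ?] [? ?]. Qed.

Lemma cReN (z : K[i]) : Re (- z) = - Re z.
Proof. by case: z. Qed.

Lemma cImN (z : K[i]) : Im (- z) = - Im z.
Proof. by case: z. Qed.

Lemma Re_mulr_real (z : K[i]) (r : K) : Re (z * r%:C) = Re z * r.
Proof. by rewrite cReM mulr0 subr0. Qed.

Lemma Im_mulr_real (z : K[i]) (r : K) : Im (z * r%:C) = Im z * r.
Proof. by rewrite cImM mulr0 add0r. Qed.

Lemma complexP (z w : K[i]) : Re z = Re w -> Im z = Im w -> z = w.
Proof. by case: z w => [? ?] [? ?] /= -> ->. Qed.

(** Continuity and differentiability are taken componentwise so that the calculus of real functions
    applies; [complex_cvg] leads back to the norm topology of [K[i]^o]. *)
Definition ccontinuous e := continuous (Re \o e) /\ continuous (Im \o e).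

Definition cderivative e e' := forall x,
  is_derive x 1 (Re \o e) (Re (e' x)) /\ is_derive x 1 (Im \o e) (Im (e' x)).

Lemma cderivative_continuous e e' : cderivative e e' -> ccontinuous e.
Proof.
move=> de; split=> x; apply/differentiable_continuous/derivable1_diffP.
  by have [[]] := de x.
by have [_ []] := de x.
Qed.

Lemma ccontinuousM e h : ccontinuous e -> ccontinuous h ->
  ccontinuous (fun x => e x * h x).
Proof.
move=> [e1 e2] [h1 h2]; split.
  rewrite (_ : _ \o _ = fun x => Re (e x) * Re (h x) - Im (e x) * Im (h x)); last first.
    by apply/funext => x /=; rewrite cReM.
  by move=> x; apply: cvgB; apply: cvgM; [exact: e1|exact: h1|exact: e2|exact: h2].
rewrite (_ : _ \o _ = fun x => Re (e x) * Im (h x) + Im (e x) * Re (h x)); last first.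
  by apply/funext => x /=; rewrite cImM.
by move=> x; apply: cvgD; apply: cvgM; [exact: e1|exact: h2|exact: e2|exact: h1].
Qed.

Lemma ccontinuousD e h : ccontinuous e -> ccontinuous h ->
  ccontinuous (fun x => e x + h x).
Proof.
move=> [e1 e2] [h1 h2]; split.
  rewrite (_ : _ \o _ = fun x => Re (e x) + Re (h x)); last first.
    by apply/funext => x /=; rewrite cReD.
  by move=> x; apply: cvgD; [exact: e1|exact: h1].
rewrite (_ : _ \o _ = fun x => Im (e x) + Im (h x)); last first.
  by apply/funext => x /=; rewrite cImD.
by move=> x; apply: cvgD; [exact: e2|exact: h2].
Qed.

Lemma ccontinuous_real phi : continuous phi -> ccontinuous (fun x => (phi x)%:C).
Proof. by move=> cphi; split; [exact: cphi|move=> x; exact: cvg_cst]. Qed.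

Lemma ccontinuous_cst (z : K[i]) : ccontinuous (cst z).
Proof. by split=> x; exact: cvg_cst. Qed.

Lemma cderivativeM e e' h h' : cderivative e e' -> cderivative h h' ->
  cderivative (fun x => e x * h x) (fun x => e' x * h x + e x * h' x).
Proof.
move=> de dh x; have [e1 e2] := de x; have [h1 h2] := dh x; split.
  rewrite (_ : _ \o _ = (Re \o e) * (Re \o h) - (Im \o e) * (Im \o h)); last first.
    by apply/funext => y /=; rewrite cReM.
  by apply: is_derive_eq; rewrite cReD !cReM /GRing.scale /=; ring.
rewrite (_ : _ \o _ = (Re \o e) * (Im \o h) + (Im \o e) * (Re \o h)); last first.
  by apply/funext => y /=; rewrite cImM.
by apply: is_derive_eq; rewrite cImD !cImM /GRing.scale /=; ring.
Qed.

Lemma cderivativeD e e' h h' : cderivative e e' -> cderivative h h' ->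
  cderivative (fun x => e x + h x) (fun x => e' x + h' x).
Proof.
move=> de dh x; have [e1 e2] := de x; have [h1 h2] := dh x; split.
  rewrite (_ : _ \o _ = (Re \o e) + (Re \o h)); last first.
    by apply/funext => y /=; rewrite cReD.
  by apply: is_derive_eq; rewrite cReD.
rewrite (_ : _ \o _ = (Im \o e) + (Im \o h)); last first.
  by apply/funext => y /=; rewrite cImD.
by apply: is_derive_eq; rewrite cImD.
Qed.

Lemma cderivative_cst (z : K[i]) : cderivative (cst z) (cst 0).
Proof. by move=> x; split; exact: is_derive_cst. Qed.

(** * Integrability of complex-valued functions *)

Definition cintegrable a b u :=
  mu.-integrable `]a, b[ (EFin \o (Re \o u)) /\ mu.-integrable `]a, b[ (EFin \o (Im \o u)).

(** A continuous factor is bounded on the compact interval [[a, b]]. *)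
Lemma integrableM_continuous a b (f h : K -> K) : continuous h ->
  mu.-integrable `]a, b[ (EFin \o f) -> mu.-integrable `]a, b[ (EFin \o (fun x => h x * f x)).
Proof.
move=> ch fi.
have : mu.-integrable `]a, b[ ((EFin \o h) \* (EFin \o f))%E.
  apply: integrableMr => //.
    by apply: measurable_funTS; exact: continuous_measurable_fun.
  have [M [Mr HM]] := compact_bounded (continuous_compact
    (continuous_subspaceT ch) (@segment_compact _ a b)).
  exists M; split=> // y My x /= /subset_itv_oo_cc xab.
  by apply: (HM _ My); exists x.
by [].
Qed.

Lemma cintegrableM a b e u : ccontinuous e -> cintegrable a b u ->
  cintegrable a b (fun x => e x * u x).
Proof.
move=> [e1 e2] [u1 u2]; split.
  rewrite (_ : _ \o _ = ((EFin \o (fun x => Re (e x) * Re (u x))%R) \-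
      (EFin \o (fun x => Im (e x) * Im (u x))%R))%E); last first.
    by apply/funext => x /=; rewrite cReM EFinB.
  by apply: integrableB => //; exact: integrableM_continuous.
rewrite (_ : _ \o _ = ((EFin \o (fun x => Re (e x) * Im (u x))%R) \+
    (EFin \o (fun x => Im (e x) * Re (u x))%R))%E); last first.
  by apply/funext => x /=; rewrite cImM EFinD.
by apply: integrableD => //; exact: integrableM_continuous.
Qed.

Lemma cintegrableD a b u g : cintegrable a b u -> cintegrable a b g ->
  cintegrable a b (fun x => u x + g x).
Proof.
move=> [u1 u2] [g1 g2]; split.
  rewrite (_ : _ \o _ = ((EFin \o (Re \o u)) \+ (EFin \o (Re \o g)))%E); last first.
    by apply/funext => x /=; rewrite cReD EFinD.
  exact: integrableD.
rewrite (_ : _ \o _ = ((EFin \o (Im \o u)) \+ (EFin \o (Im \o g)))%E); last first.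
  by apply/funext => x /=; rewrite cImD EFinD.
exact: integrableD.
Qed.

Lemma cintegrable_continuous a b e : ccontinuous e -> cintegrable a b e.
Proof.
have h (f : K -> K) : continuous f -> mu.-integrable `]a, b[ (EFin \o f).
  move=> cf; apply: integrableS (_ : mu.-integrable `[a, b] _) => //.
    exact: subset_itv_oo_cc.
  apply: continuous_compact_integrable; first exact: segment_compact.
  exact: continuous_subspaceT.
by move=> [e1 e2]; split; exact: h.
Qed.

(** On a bounded interval constants are integrable, and each component is dominated by 1 + |u|^2. *)
Lemma cintegrable_L2 a b u : L2 `]a, b[ u -> cintegrable a b u.
Proof.
move=> [m1 m2 fin].
pose s x := Re (u x) ^+ 2 + Im (u x) ^+ 2.
have ms : measurable_fun `]a, b[ s.
  by apply: measurable_funD; exact: measurable_funX.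
have s0 x : 0 <= s x by rewrite addr_ge0 ?sqr_ge0.
have is' : mu.-integrable `]a, b[ (EFin \o s).
  apply/integrableP; split; first exact/measurable_EFinP.
  by under eq_integral do rewrite /= ger0_norm //.
have i1 : mu.-integrable `]a, b[ (EFin \o cst 1).
  apply: (@cintegrable_continuous a b (cst 1) _).1; exact: ccontinuous_cst.
have h (f : K -> K) : measurable_fun `]a, b[ f -> (forall x, f x ^+ 2 <= s x) ->
    mu.-integrable `]a, b[ (EFin \o f).
  move=> mf fs; apply: (le_integrable _ _ _ (integrableD _ i1 is')) => //.
    exact/measurable_EFinP.
  move=> x _ /=; rewrite lee_fin [leRHS]ger0_norm; last by apply: addr_ge0 => //; exact: s0.
  have := fs x; rewrite -(real_normK (num_real (f x))) => fx.
  (* Expanding this square gives |f| <= f^2 + 1/4. *)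
  have := sqr_ge0 (`|f x| - 2^-1); nra.
split; apply: h => // x; rewrite /s.
  by rewrite lerDl; exact: sqr_ge0.
by rewrite lerDr; exact: sqr_ge0.
Qed.

Lemma cintegralD a b u g : cintegrable a b u -> cintegrable a b g ->
  cintegral `]a, b[ (fun x => u x + g x) = cintegral `]a, b[ u + cintegral `]a, b[ g.
Proof.
move=> [u1 u2] [g1 g2]; apply: complexP; rewrite /cintegral /=.
  by under eq_Rintegral do rewrite cReD; rewrite RintegralD.
by under eq_Rintegral do rewrite cImD; rewrite RintegralD.
Qed.

Lemma cintegralZ a b (z : K[i]) u : cintegrable a b u ->
  cintegral `]a, b[ (fun x => z * u x) = z * cintegral `]a, b[ u.
Proof.
have h c (f : K -> K) : mu.-integrable `]a, b[ (EFin \o f) ->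
    mu.-integrable `]a, b[ (EFin \o (fun x => c * f x)).
  by apply: (@integrableM_continuous _ _ _ (cst c)) => x; exact: cvg_cst.
move=> [u1 u2]; apply: complexP; rewrite /cintegral ?cReM ?cImM /=.
  under eq_Rintegral do rewrite cReM.
  by rewrite RintegralB ?RintegralZl //; exact: h.
under eq_Rintegral do rewrite cImM.
by rewrite RintegralD ?RintegralZl //; exact: h.
Qed.

Lemma cintegralN a b u : cintegrable a b u ->
  cintegral `]a, b[ (fun x => - u x) = - cintegral `]a, b[ u.
Proof.
by move=> ui; rewrite -mulN1r -cintegralZ //; congr cintegral; apply/funext => x; rewrite mulN1r.
Qed.

(** * Calculus of weak derivatives *)

Lemma test_functionM a b (r r' : K -> K) phi :
  (forall x, is_derive x 1 r (r' x)) -> continuous r' ->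
  test_function a b phi -> test_function a b (fun x => r x * phi x).
Proof.
move=> dr cr' [dphi cphi' cpt sub].
have cr : continuous r.
  by move=> x; apply/differentiable_continuous/derivable1_diffP; have [] := dr x.
have cphi : continuous phi.
  by move=> x; apply/differentiable_continuous/derivable1_diffP.
have d x : is_derive x 1 (r * phi) (r x * derive1 phi x + r' x * phi x).
  have := dphi x => /derivableP; rewrite -derive1E => dp.
  by apply: is_derive_eq; rewrite /GRing.scale /= (mulrC (phi x)).
have sub' : closure [set x | r x * phi x != 0] `<=` closure [set x | phi x != 0].
  by apply: closureS => x /=; rewrite mulf_eq0 negb_or => /andP[].
split.
- by move=> x; have [] := d x.
- rewrite (_ : derive1 _ = fun x => r x * derive1 phi x + r' x * phi x).
    by move=> x; apply: cvgD; apply: cvgM; [exact: cr|exact: cphi'|exact: cr'|exact: cphi].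
  by apply/funext => x; rewrite derive1E; have [] := d x.
- exact: (subclosed_compact (@closed_closure _ _) cpt sub').
- by move=> x /sub' /sub.
Qed.

Lemma cintegrable_test a b u phi : test_function a b phi -> cintegrable a b u ->
  cintegrable a b (fun x => u x * (phi x)%:C).
Proof.
move=> [dphi _ _ _] ui.
have cphi : continuous phi.
  by move=> x; apply/differentiable_continuous/derivable1_diffP.
have := cintegrableM (ccontinuous_real cphi) ui.
by congr cintegrable; apply/funext => x; rewrite mulrC.
Qed.

Lemma cintegrable_test' a b u phi : test_function a b phi -> cintegrable a b u ->
  cintegrable a b (fun x => u x * (derive1 phi x)%:C).
Proof.
move=> [_ cphi _ _] ui.
have := cintegrableM (ccontinuous_real cphi) ui.
by congr cintegrable; apply/funext => x; rewrite mulrC.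
Qed.

(* The test functions being real, the weak equation is applied to [Re e * phi]
   and [Im e * phi] separately. *)
Lemma weak_derivativeM a b u g e e' : cintegrable a b u -> cintegrable a b g ->
  cderivative e e' -> ccontinuous e' -> weak_derivative a b u g ->
  weak_derivative a b (fun x => e x * u x) (fun x => e x * g x + e' x * u x).
Proof.
move=> ui gi de ce w phi tphi; have [ce1 ce2] := ce.
have ece := cderivative_continuous de.
have [dphi cphi' _ _] := tphi.
have t1 := test_functionM (fun x => (de x).1) ce1 tphi.
have t2 := test_functionM (fun x => (de x).2) ce2 tphi.
have d (r : K -> K) x (l : K) : is_derive x 1 r l ->
    derive1 (fun y => r y * phi y) x = r x * derive1 phi x + phi x * l.
  move=> dr; have := dphi x => /derivableP; rewrite -derive1E => dp.
  by rewrite derive1E; have [_ ->] : is_derive x 1 (r * phi) _ := is_deriveM dr dp.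
set phi1 := fun x => _ in t1; set phi2 := fun x => _ in t2.
have w1 := w _ t1; have w2 := w _ t2.
pose I : K[i] := 0 +i* 1.
have ei := cintegrableM ce ui.
(* The product rule for e phi, solved for the wanted term: u e phi' = u (Re e phi)' + i u (Im e
   phi)' - e' u phi. *)
rewrite (_ : (fun x => e x * u x * _) = (fun x => (u x * (derive1 phi1 x)%:C +
    I * (u x * (derive1 phi2 x)%:C)) + - ((e' x * u x) * (phi x)%:C))); last first.
  apply/funext => x; rewrite (d (Re \o e) x _ (de x).1) (d (Im \o e) x _ (de x).2) /=.
  by apply: complexP; rewrite !(cReD, cImD, cReN, cImN, cReM, cImM) /=; ring.
have i1 := cintegrable_test' t1 ui; have i2 := cintegrable_test' t2 ui.
have j1 := cintegrable_test t1 gi; have j2 := cintegrable_test t2 gi.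
have k := cintegrable_test tphi ei.
have Ii h : cintegrable a b h -> cintegrable a b (fun x => I * h x).
  by move=> hi; exact: (cintegrableM (ccontinuous_cst I)).
have Ni h : cintegrable a b h -> cintegrable a b (fun x => - h x).
  move=> hi; have := cintegrableM (ccontinuous_cst (-1)) hi.
  by congr cintegrable; apply/funext => x; rewrite mulN1r.
rewrite !cintegralD ?cintegralZ ?cintegralN //;
  try by [exact: Ni|exact: Ii|apply: cintegrableD => //; exact: Ii].
rewrite w1 w2 mulrN -!opprD; congr (- _).
rewrite -cintegralZ // -!cintegralD //; try by [exact: Ii|apply: cintegrableD => //; exact: Ii].
congr cintegral; apply/funext => x.
by apply: complexP; rewrite /phi1 /phi2 !(cReD, cImD, cReN, cImN, cReM, cImM) /=; ring.
Qed.

(** The points [a] and [b] lie outside the support of [phi], so the boundary terms of the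
    fundamental theorem vanish. *)
Lemma Rintegral_derive_test a b phi : test_function a b phi ->
  \int[mu]_(x in `]a, b[) derive1 phi x = 0.
Proof.
move=> [dphi cphi' _ sub]; have [ba|ab] := leP b a.
  by rewrite set_itv_ge ?Rintegral_set0 // bnd_simp -leNgt.
have cphi : continuous phi.
  by move=> x; apply/differentiable_continuous/derivable1_diffP.
have phi0 x : x \notin `]a, b[ -> phi x = 0.
  move=> xab; apply/eqP; apply: contraNT xab => px.
  exact/sub/subset_closure.
have := @continuous_FTC2 K (derive1 phi) phi a b ab.
rewrite !phi0 ?in_itv /= ?ltxx ?andbF // subee // => FTC.
have di : mu.-integrable `[a, b] (EFin \o derive1 phi).
  apply: continuous_compact_integrable; first exact: segment_compact.
  exact: continuous_subspaceT.
rewrite Rintegral_itv_obnd_cbnd; last by apply: integrableS di => //; exact: subset_itv_oo_cc.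
rewrite Rintegral_itv_bndo_bndc; last first.
  by apply: integrableS di => //; apply: subset_itvl; rewrite bnd_simp.
rewrite /Rintegral FTC //; first exact: continuous_subspaceT.
split=> //.
- by apply: cvg_at_right_filter; exact: cphi.
- by apply: cvg_at_left_filter; exact: cphi.
Qed.
Lemma weak_derivative_cst1 a b : weak_derivative a b (cst 1) (cst 0).
Proof.
move=> phi tphi; have i0 := Rintegral_derive_test tphi.
rewrite (_ : (fun x => cst 1 x * _) = fun x => (derive1 phi x)%:C); last first.
  by apply/funext => x; rewrite mul1r.
rewrite (_ : (fun x => cst 0 x * _) = fun x => 0%:C); last first.
  by apply/funext => x; rewrite mul0r.
have z : \int[mu]_(x in `]a, b[) (0 : K) = 0 by rewrite Rintegral_cst // mul0r.
by apply: complexP; rewrite ?cReN ?cImN /cintegral /= ?z ?i0 oppr0.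
Qed.

(** This is the product rule [weak_derivativeM] for [e] times the constant 1, so integration by
    parts is carried out for the constant only. *)
Lemma weak_derivative_C1 a b e e' : cderivative e e' -> ccontinuous e' ->
  weak_derivative a b e e'.
Proof.
move=> de ce'.
have := weak_derivativeM (cintegrable_continuous a b (ccontinuous_cst 1))
  (cintegrable_continuous a b (ccontinuous_cst 0)) de ce' (@weak_derivative_cst1 a b).
congr weak_derivative; apply/funext => x /=; first by rewrite mulr1.
by rewrite mulr0 add0r mulr1.
Qed.

Lemma weak_derivativeD a b u g u' g' : cintegrable a b u -> cintegrable a b g ->
  cintegrable a b u' -> cintegrable a b g' ->
  weak_derivative a b u u' -> weak_derivative a b g g' ->
  weak_derivative a b (fun x => u x + g x) (fun x => u' x + g' x).
Proof.
move=> ui gi ui' gi' wu wg phi t.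
have E (p q : K -> K[i]) (r : K -> K) : (fun x => (p x + q x) * (r x)%:C) =
  (fun x => p x * (r x)%:C + q x * (r x)%:C) by apply/funext => x; rewrite mulrDl.
rewrite !E !cintegralD; first by rewrite wu // wg // opprD.
all: by [exact: (cintegrable_test t)|exact: (cintegrable_test' t)].
Qed.

Lemma cintegral_ae a b u g : cintegrable a b u -> cintegrable a b g ->
  u = g %[ae mu in [set` `]a, b[]] -> cintegral `]a, b[ u = cintegral `]a, b[ g.
Proof.
move=> [u1 u2] [g1 g2] ug.
apply: complexP; rewrite /cintegral /= /Rintegral; congr fine; apply: ae_eq_integral => //.
- exact: measurable_int u1.
- exact: measurable_int g1.
- by apply: ae_mono ug => x h /h /= ->.
- exact: measurable_int u2.
- exact: measurable_int g2.
- by apply: ae_mono ug => x h /h /= ->.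
Qed.

Lemma weak_derivative_ae a b u g h : cintegrable a b g -> cintegrable a b h ->
  weak_derivative a b u g -> g = h %[ae mu in [set` `]a, b[]] -> weak_derivative a b u h.
Proof.
move=> gi hi w gh phi t; rewrite w //; congr (- _); apply: cintegral_ae.
- exact: cintegrable_test.
- exact: cintegrable_test.
- by apply: ae_mono gh => x k /k ->.
Qed.

Lemma weak_derivative_unique a b u g h : cintegrable a b g -> cintegrable a b h ->
  weak_derivative a b u g -> weak_derivative a b u h -> g = h %[ae mu in [set` `]a, b[]].
Proof.
move=> gi hi wg wh.
have eqI phi : test_function a b phi ->
    cintegral `]a, b[ (fun x => g x * (phi x)%:C) = cintegral `]a, b[ (fun x => h x * (phi x)%:C).
  by move=> t; apply: oppr_inj; rewrite -wg // wh.
(* Here [p] stands for the real or the imaginary part; since it commutes with real factors, the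
   complex identity yields a real one for [fundamental_lemma]. *)
have key (p : K[i] -> K) : (forall z (r : K), p (z * r%:C) = p z * r) ->
    mu.-integrable `]a, b[ (EFin \o (p \o g)) -> mu.-integrable `]a, b[ (EFin \o (p \o h)) ->
    (forall phi, test_function a b phi ->
      [/\ \int[mu]_(x in `]a, b[) p (g x * (phi x)%:C) =
          \int[mu]_(x in `]a, b[) p (h x * (phi x)%:C),
        mu.-integrable `]a, b[ (EFin \o (p \o (fun x => g x * (phi x)%:C))) &
        mu.-integrable `]a, b[ (EFin \o (p \o (fun x => h x * (phi x)%:C)))]) ->
    (fun x => p (g x) - p (h x)) = cst 0 %[ae mu in [set` `]a, b[]].
  move=> pM pg ph H; apply: fundamental_lemma; first exact: (integrableB _ pg ph).
  move=> phi t; under eq_Rintegral do rewrite mulrBl -!pM.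
  by have [e ig ih] := H _ t; rewrite RintegralB // e subrr.
have hr := key Re Re_mulr_real gi.1 hi.1 (fun phi t => And3 (congr1 Re (eqI _ t))
  (cintegrable_test t gi).1 (cintegrable_test t hi).1).
have hm := key Im Im_mulr_real gi.2 hi.2 (fun phi t => And3 (congr1 Im (eqI _ t))
  (cintegrable_test t gi).2 (cintegrable_test t hi).2).
apply: ae_mono2 hr hm => x hr hm xab; apply: complexP.
  by apply/eqP; rewrite -subr_eq0; apply/eqP/hr.
by apply/eqP; rewrite -subr_eq0; apply/eqP/hm.
Qed.

Lemma weak_derivative0 a b u : cintegrable a b u -> weak_derivative a b u (cst 0) ->
  exists z, u = cst z %[ae mu in [set` `]a, b[]].
Proof.
move=> ui w.
have z0 phi : test_function a b phi -> cintegral `]a, b[ (fun x => u x * (derive1 phi x)%:C) = 0.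
  move=> t; rewrite w // (_ : (fun x => _) = fun x => 0 * cst 0 x); last first.
    by apply/funext => x; rewrite /= !mul0r.
  by rewrite cintegralZ ?mul0r ?oppr0 //; apply/cintegrable_continuous/ccontinuous_cst.
have [|m1 h1] := @du_bois_reymond K a b (Re \o u) ui.1.
  move=> phi t; under eq_Rintegral do rewrite /= -Re_mulr_real.
  exact: (congr1 Re (z0 _ t)).
have [|m2 h2] := @du_bois_reymond K a b (Im \o u) ui.2.
  move=> phi t; under eq_Rintegral do rewrite /= -Im_mulr_real.
  exact: (congr1 Im (z0 _ t)).
exists (m1 +i* m2); apply: ae_mono2 h1 h2 => x h1 h2 xab.
by apply: complexP; [exact: h1|exact: h2].
Qed.

End ComplexCalculus.

(** * Matrix exponentials *)

Section MatrixExponential.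
Variable K : realType.
Local Notation Re := (@complex.Re K).
Local Notation Im := (@complex.Im K).
Implicit Types (c d : nat -> K) (z w : nat -> K[i]) (F : 'M[K[i]]_2).

(** This growth condition forces convergence everywhere and is stable under sums, scalar multiples
    and formal differentiation, so power series may be differentiated termwise at every point. *)
Definition exp_dominated c := exists B M : K,
  [/\ 0 <= B, 0 <= M & forall k, `|c k| <= B * M ^+ k / k`!%:R].

Definition psum c (x : K) : K := limn (pseries c x).

Lemma exp_dominated_cvg c x : exp_dominated c -> cvgn (pseries c x).
Proof.
move=> [B [M [B0 M0 cB]]]; apply: normed_cvg.
apply: (@series_le_cvg _ _ (fun k => B * exp_coeff (M * `|x|) k)).
- by move=> k; exact: normr_ge0.
- by move=> k; rewrite mulr_ge0 // exp_coeff_ge0 // mulr_ge0.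
- move=> k /=; rewrite normrM normrX /exp_coeff /= exprMn.
  by rewrite (le_trans (ler_wpM2r _ (cB k))) ?exprn_ge0 // !mulrA -!(mulrAC _ (k`!%:R^-1)).
by apply: is_cvg_seriesZ; exact: is_cvg_series_exp_coeff.
Qed.

Lemma exp_dominated_diffs c : exp_dominated c -> exp_dominated (pseries_diffs c).
Proof.
move=> [B [M [B0 M0 cB]]]; exists (B * M), M; split=> // [|k]; first exact: mulr_ge0.
rewrite /pseries_diffs normrM normr_nat.
apply: le_trans (ler_wpM2l _ (cB k.+1)) _ => //.
rewrite factS natrM exprS le_eqVlt; apply/orP; left; apply/eqP.
have kn : k`!%:R != 0 :> K by rewrite pnatr_eq0 -lt0n fact_gt0.
have k1 : k.+1%:R != 0 :> K by rewrite pnatr_eq0.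
by move: (k.+1%:R) (k`!%:R) kn k1 => p q q0 p0; field; rewrite p0 q0.
Qed.

Lemma is_derive_psum c (x : K) : exp_dominated c ->
  is_derive x 1 (psum c) (psum (pseries_diffs c) x).
Proof.
(* Termwise differentiation at [x] asks for convergence of the series and of its first two formal
   derivatives at a point of larger modulus; |x| + 1 is one. *)
move=> ec; apply: (@pseries_snd_diffs _ _ (`|x| + 1)).
- exact: exp_dominated_cvg.
- exact/exp_dominated_cvg/exp_dominated_diffs.
- exact/exp_dominated_cvg/exp_dominated_diffs/exp_dominated_diffs.
- by rewrite [ltRHS]ger0_norm ?addr_ge0 // ltrDl.
Qed.

Lemma exp_dominatedZ (r : K) c : exp_dominated c -> exp_dominated (fun k => r * c k).
Proof.
move=> [B [M [B0 M0 cB]]]; exists (`|r| * B), M; split=> // [|k]; first exact: mulr_ge0.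
by rewrite normrM -!mulrA ler_wpM2l // mulrA.
Qed.

Lemma exp_dominatedD c d : exp_dominated c -> exp_dominated d ->
  exp_dominated (fun k => c k + d k).
Proof.
move=> [B [M [B0 M0 cB]]] [B' [M' [B0' M0' dB]]].
(* Both [M ^+ k] and [M' ^+ k] are at most [(M + M') ^+ k]. *)
exists (B + B'), (M + M'); split; rewrite ?addr_ge0 // => k.
apply: le_trans (ler_normD _ _) _; rewrite mulrDl mulrDl.
apply: lerD; [apply: le_trans (cB k) _|apply: le_trans (dB k) _].
  by rewrite ler_wpM2r ?invr_ge0 // ler_wpM2l // lerXn2r ?nnegrE ?addr_ge0 // lerDl.
by rewrite ler_wpM2r ?invr_ge0 // ler_wpM2l // lerXn2r ?nnegrE ?addr_ge0 // lerDr.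
Qed.

Lemma psumD c d x : exp_dominated c -> exp_dominated d ->
  psum (fun k => c k + d k) x = psum c x + psum d x.
Proof.
move=> ec ed; rewrite /psum -limD; try exact: exp_dominated_cvg.
congr (limn _); apply/funext => n; rewrite fctE /pseries /series /= -big_split.
by apply: eq_bigr => k _; rewrite mulrDl.
Qed.

Lemma psumZ (r : K) c x : exp_dominated c -> psum (fun k => r * c k) x = r * psum c x.
Proof.
move=> ec; apply: cvg_lim => //.
rewrite (_ : pseries _ _ = fun n => r * pseries c x n).
  by apply: cvgMl_tmp; exact: exp_dominated_cvg.
apply/funext => n; rewrite /pseries /series /= mulr_sumr.
by apply: eq_bigr => k _; rewrite mulrA.
Qed.

Lemma psum0 c : psum c 0 = c 0%N.
Proof.
apply: lim_near_cst => //; near=> n.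
have n0 : (0 < n)%N by near: n; exact: nbhs_infty_gt.
rewrite -(prednK n0).
rewrite /pseries /series /= big_nat_recl // expr0 mulr1 big1 ?addr0 // => k _.
by rewrite exprS mul0r mulr0.
Unshelve. all: by end_near.
Qed.

Definition cexp_dominated z := exp_dominated (Re \o z) /\ exp_dominated (Im \o z).

Definition cpsum z (x : K) : K[i] := psum (Re \o z) x +i* psum (Im \o z) x.

Lemma cpsum0 z : cpsum z 0 = z 0%N.
Proof. by apply: complexP; rewrite /= psum0. Qed.

Lemma cexp_dominatedZ (r : K[i]) z : cexp_dominated z -> cexp_dominated (fun k => r * z k).
Proof.
move=> [z1 z2]; split.
  rewrite (_ : _ \o _ = fun k => Re r * (Re \o z) k + (- Im r) * (Im \o z) k); last first.
    by apply/funext => k; rewrite /= cReM mulNr.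
  by apply: exp_dominatedD; exact: exp_dominatedZ.
rewrite (_ : _ \o _ = fun k => Re r * (Im \o z) k + Im r * (Re \o z) k); last first.
  by apply/funext => k; rewrite /= cImM.
by apply: exp_dominatedD; exact: exp_dominatedZ.
Qed.

Lemma cpsumZ (r : K[i]) z x : cexp_dominated z -> cpsum (fun k => r * z k) x = r * cpsum z x.
Proof.
move=> [z1 z2]; apply: complexP; rewrite ?cReM ?cImM /=.
  rewrite (_ : _ \o _ = fun k => Re r * (Re \o z) k + (- Im r) * (Im \o z) k); last first.
    by apply/funext => k; rewrite /= cReM mulNr.
  by rewrite psumD; [rewrite !psumZ // mulNr|exact: exp_dominatedZ|exact: exp_dominatedZ].
rewrite (_ : _ \o _ = fun k => Re r * (Im \o z) k + Im r * (Re \o z) k); last first.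
  by apply/funext => k; rewrite /= cImM.
by rewrite psumD; [rewrite !psumZ|exact: exp_dominatedZ|exact: exp_dominatedZ].
Qed.

Lemma cpsumD z w x : cexp_dominated z -> cexp_dominated w ->
  cpsum (fun k => z k + w k) x = cpsum z x + cpsum w x.
Proof.
move=> [z1 z2] [w1 w2]; apply: complexP; rewrite /=.
  by rewrite -psumD //; congr psum; apply/funext => k; rewrite /= cReD.
by rewrite -psumD //; congr psum; apply/funext => k; rewrite /= cImD.
Qed.

Lemma cderivative_cpsum z : cexp_dominated z ->
  cderivative (cpsum z) (cpsum (fun k => k.+1%:R * z k.+1)).
Proof.
move=> [z1 z2] x; have h n : n%:R = (n%:R : K)%:C :> K[i] by rewrite rmorph_nat.
split.
  apply: is_derive_eq (is_derive_psum x z1) _; congr psum.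
  by apply/funext => k; rewrite /= h cReM mul0r subr0.
apply: is_derive_eq (is_derive_psum x z2) _; congr psum.
by apply/funext => k; rewrite /= h cImM mul0r addr0.
Qed.

(** * The matrix exponential as a function of real time *)

Definition exp_coef F i j k : K[i] := (k`!%:R)^-1 * (F ^+ k) i j.

(** This is e^{xF}, entry by entry as a power series in the real variable [x], which makes it
    differentiable by [cderivative_cpsum]; [expmxE] identifies its value at 1 with [expmx F]. *)
Definition mexp F x : 'M[K[i]]_2 := \matrix_(i, j) cpsum (exp_coef F i j) x.

(** The real or imaginary part of an entry of a product of two complex 2x2 matrices is a signed sum
    of four real products, hence the factor 4 per power. *)
Lemma Re_expmx_bound F (N : K) : 0 <= N ->
  (forall i j, `|Re (F i j)| <= N /\ `|Im (F i j)| <= N) ->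
  forall k i j, `|Re ((F ^+ k) i j)| <= (4 * N) ^+ k /\ `|Im ((F ^+ k) i j)| <= (4 * N) ^+ k.
Proof.
move=> N0 FN; elim=> [|k IH] i j.
  rewrite expr0 mxE; case: eqP => _ /=; rewrite ?normr0 ?normr1 ler01 ?lexx //.
have aux (p q r s p' q' r' s' : K) M : 0 <= M -> `|p| <= N -> `|q| <= N -> `|r| <= N -> `|s| <= N ->
    `|p'| <= M -> `|q'| <= M -> `|r'| <= M -> `|s'| <= M ->
    `|p * p' + q * q' + (r * r' + s * s')| <= 4 * N * M.
  move=> M0 hp hq hr hs hp' hq' hr' hs'.
  have t (u v : K) : `|u| <= N -> `|v| <= M -> `|u * v| <= N * M.
    by move=> hu hv; rewrite normrM ler_pM.
  apply: le_trans (ler_normD _ _) _.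
  have := ler_normD (p * p') (q * q'); have := ler_normD (r * r') (s * s').
  have := t _ _ hp hp'; have := t _ _ hq hq'; have := t _ _ hr hr'; have := t _ _ hs hs'.
  nra.
have M0 : 0 <= (4 * N) ^+ k by rewrite exprn_ge0 // mulr_ge0.
rewrite (exprS (4 * N)) exprS mxE !big_ord_recl big_ord0 addr0.
have [r1 i1] := FN i ord0; have [r2 i2] := FN i (lift ord0 ord0).
have [r1' i1'] := IH ord0 j; have [r2' i2'] := IH (lift ord0 ord0) j.
rewrite cReD cImD !cReM !cImM -!mulNr; split; apply: aux; rewrite ?normrN //.
Qed.

Lemma cexp_dominated_coef F i j : cexp_dominated (exp_coef F i j).
Proof.
pose N := \sum_i \sum_j (`|Re (F i j)| + `|Im (F i j)|).
have N0 : 0 <= N by apply: sumr_ge0 => ? _; apply: sumr_ge0 => ? _; rewrite addr_ge0.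
have FN k l : `|Re (F k l)| + `|Im (F k l)| <= N.
  rewrite /N (bigD1 k) //= [X in _ <= X + _](bigD1 l) //= -[leRHS]addrA lerDl.
  by rewrite addr_ge0 //; repeat (apply: sumr_ge0 => ? _); rewrite addr_ge0.
have H k : `|Re ((F ^+ k) i j)| <= (4 * N) ^+ k /\ `|Im ((F ^+ k) i j)| <= (4 * N) ^+ k.
  apply: (Re_expmx_bound N0) => k' l; have := FN k' l.
  have := normr_ge0 (Re (F k' l)); have := normr_ge0 (Im (F k' l)); lra.
have E n : (n%:R : K[i])^-1 = (n%:R^-1 : K)%:C by rewrite fmorphV rmorph_nat.
split; exists 1, (4 * N); split; rewrite ?mulr_ge0 // => k /=; rewrite /exp_coef E.
  rewrite cReM mul0r subr0 normrM mul1r mulrC [`|_^-1|]ger0_norm ?invr_ge0 //.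
  by rewrite ler_wpM2r ?invr_ge0 //; case: (H k).
rewrite cImM mul0r addr0 normrM mul1r mulrC [`|_^-1|]ger0_norm ?invr_ge0 //.
by rewrite ler_wpM2r ?invr_ge0 //; case: (H k).
Qed.

(** This recursion comes from F^{k+1} = F F^k, and [exp_coefSr] from F^k F. Having both allows
    e^{tF} to be differentiated with [F] on either side, as convenient. *)
Lemma exp_coefS F i j k : k.+1%:R * exp_coef F i j k.+1 = \sum_l F i l * exp_coef F l j k.
Proof.
rewrite /exp_coef factS natrM invfM !mulrA divff ?pnatr_eq0 // mul1r exprS mxE mulr_sumr.
by apply: eq_bigr => l _; rewrite mulrCA.
Qed.

Lemma exp_coefSr F i j k : k.+1%:R * exp_coef F i j k.+1 = \sum_l exp_coef F i l k * F l j.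
Proof.
rewrite /exp_coef factS natrM invfM !mulrA divff ?pnatr_eq0 // mul1r exprSr mxE mulr_sumr.
by apply: eq_bigr => l _; rewrite mulrA.
Qed.

Lemma sum_ord2 (V : nmodType) (f : 'I_2 -> V) : \sum_i f i = f 0 + f 1.
Proof. by rewrite !big_ord_recl big_ord0 addr0; congr (_ + f _); exact: val_inj. Qed.

Lemma mulmx2E m n (A : 'M[K[i]]_(m, 2)) (B : 'M[K[i]]_(2, n)) i j :
  (A *m B) i j = A i 0 * B 0 j + A i 1 * B 1 j.
Proof. by rewrite mxE sum_ord2. Qed.

Lemma cderivative_mexp F i j :
  cderivative (fun t => mexp F t i j) (fun t => (F *m mexp F t) i j).
Proof.
have := cderivative_cpsum (cexp_dominated_coef F i j).
congr cderivative; apply/funext => t; rewrite !mxE // sum_ord2 !mxE.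
rewrite -!cpsumZ -?cpsumD; try exact: cexp_dominatedZ (cexp_dominated_coef _ _ _);
  try exact: cexp_dominated_coef.
by congr cpsum; apply/funext => k; rewrite exp_coefS sum_ord2.
Qed.

Lemma cderivative_mexpr F i j :
  cderivative (fun t => mexp F t i j) (fun t => (mexp F t *m F) i j).
Proof.
have := cderivative_cpsum (cexp_dominated_coef F i j).
congr cderivative; apply/funext => t; rewrite !mxE // sum_ord2 !mxE.
rewrite ![_ * F _ _]mulrC -!cpsumZ -?cpsumD; try exact: cexp_dominatedZ (cexp_dominated_coef _ _ _);
  try exact: cexp_dominated_coef.
by congr cpsum; apply/funext => k; rewrite exp_coefSr sum_ord2 ![_ * F _ _]mulrC.
Qed.

Lemma mexp0 F : mexp F 0 = 1%:M.
Proof.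
by apply/matrixP => i j; rewrite mxE cpsum0 /exp_coef fact0 invr1 mul1r expr0.
Qed.

Lemma cnorm_le (w : K[i]) : Im `|w| = 0 /\ Re `|w| <= `|Re w| + `|Im w|.
Proof.
case: w => p q; rewrite normc_def /=; split=> //.
rewrite -[leRHS]ger0_norm ?addr_ge0 // -sqrtr_sqr ler_sqrt ?sqr_ge0 //.
have := normr_ge0 p; have := normr_ge0 q.
rewrite -(real_normK (num_real p)) -(real_normK (num_real q)); nra.
Qed.

Lemma le_cnorm (w : K[i]) : `|Re w| <= Re `|w| /\ `|Im w| <= Re `|w|.
Proof.
case: w => p q; rewrite normc_def /= -2!sqrtr_sqr.
have := sqr_ge0 p; have := sqr_ge0 q => p0 q0.
by split; rewrite ler_sqrt ?addr_ge0 // ?lerDl ?lerDr.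
Qed.

(** The norm of [K[i]] takes values in [K[i]], so the tolerance is a complex number; [0 < e] forces
    its imaginary part to be 0. *)
Lemma complex_cvg (T : Type) (G : set_system T) (FG : Filter G) (f : T -> K[i]) (z : K[i]) :
  Re (f x) @[x --> G] --> Re z -> Im (f x) @[x --> G] --> Im z ->
  f x @[x --> G] --> (z : K[i]^o).
Proof.
move=> /cvgrPdist_lt h1 /cvgrPdist_lt h2; apply/(@cvgrPdist_lt _ K[i]^o) => e.
rewrite ltcE /= => /andP[/eqP Ie Re0].
have e2 : 0 < Re e / 2 by rewrite divr_gt0.
apply: filterS2 (h1 _ e2) (h2 _ e2) => x k1 k2.
have [i0 rle] := cnorm_le (z - f x); rewrite cReD cReN cImD cImN in rle.
by rewrite ltcE Ie i0 eqxx /= (le_lt_trans rle) // [ltRHS]splitr ltrD.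
Qed.

Lemma cvg_complex (T : Type) (G : set_system T) (FG : Filter G) (f : T -> K[i]) (z : K[i]) :
  f x @[x --> G] --> (z : K[i]^o) ->
  Re (f x) @[x --> G] --> Re z /\ Im (f x) @[x --> G] --> Im z.
Proof.
move=> /(@cvgrPdist_lt _ K[i]^o) h.
have h' (e : K) : 0 < e -> \forall x \near G, Re `|z - f x| < e.
  move=> e0; have /h : 0 < e%:C by rewrite ltcE /= eqxx.
  by apply: filterS => x; rewrite ltcE /= => /andP[_].
split; apply/cvgrPdist_lt => e /h'; apply: filterS => x; apply: le_lt_trans.
  by rewrite -cReN -cReD; case: (le_cnorm (z - f x)).
by rewrite -cImN -cImD; case: (le_cnorm (z - f x)).
Qed.

Lemma mx_cvg (T : Type) (G : set_system T) (FG : Filter G) (f : T -> 'M[K[i]^o]_2)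
  (M : 'M[K[i]^o]_2) :
  (forall i j, f x i j @[x --> G] --> M i j) -> f x @[x --> G] --> M.
Proof.
move=> h; apply/cvg_ballP => e e0.
have : \forall x \near G, forall i j, ball (M i j) e (f x i j).
  by apply: filter_forall => i; apply: filter_forall => j; move/cvg_ballP: (h i j); apply.
by apply: filterS => x hx; split.
Qed.

Lemma expmxE F : expmx F = mexp F 1.
Proof.
rewrite /expmx; apply: (@cvg_lim 'M[K[i]^o]_2); first exact: norm_hausdorff.
apply: mx_cvg => i j.
rewrite mxE.
have [d1 d2] := cexp_dominated_coef F i j.
have S n (p : {additive K[i] -> K}) : p ((\sum_(k < n) (k`!%:R)^-1 *: F ^+ k) i j) =
    pseries (p \o exp_coef F i j) 1 n.
  rewrite summxE raddf_sum /pseries /series /= big_mkord.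
  by apply: eq_bigr => k _; rewrite mxE expr1n mulr1.
apply: complex_cvg.
  under eq_cvg do rewrite (S _ Re).
  exact: exp_dominated_cvg.
under eq_cvg do rewrite (S _ Im).
exact: exp_dominated_cvg.
Qed.

End MatrixExponential.

(** * Weak linear systems on an interval *)

Section WeakODE.
Variable K : realType.
Local Notation mu := (@lebesgue_measure K).
Local Notation Re := (@complex.Re K).
Local Notation Im := (@complex.Im K).
Implicit Types (a b x t : K) (u w e g : K -> K[i]) (F : 'M[K[i]]_2).

Lemma cderivativeN_comp e e' : cderivative e e' ->
  cderivative (fun t => e (- t)) (fun t => - e' (- t)).
Proof.
move=> de x; have [e1 e2] := de (- x).
have dN : is_derive x 1 (-%R : K -> K) (- 1) by exact: is_deriveNid.
split.
  have := is_derive1_comp e1 dN; rewrite mulrN1 cReN; exact.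
have := is_derive1_comp e2 dN; rewrite mulrN1 cImN; exact.
Qed.

Lemma cderivative_shift a e e' : cderivative e e' ->
  cderivative (fun t => e (t - a)) (fun t => e' (t - a)).
Proof.
move=> de x; have [e1 e2] := de (x - a).
have dB : is_derive x 1 (fun t => t - a) 1.
  by apply: is_derive_eq; rewrite subr0.
split.
  have := @is_derive1_comp _ (Re \o e) (fun t => t - a) _ _ _ e1 dB; rewrite mulr1; exact.
have := @is_derive1_comp _ (Im \o e) (fun t => t - a) _ _ _ e2 dB; rewrite mulr1; exact.
Qed.

Lemma cderivative0_cst e : cderivative e (cst 0) -> forall x t, e x = e t.
Proof.
move=> de x t; apply: complexP.
  by apply: (@is_derive_0_is_cst _ (Re \o e)) => y; case: (de y).
by apply: (@is_derive_0_is_cst _ (Im \o e)) => y; case: (de y).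
Qed.

(** The derivative is e^{tF} F e^{-tF} - e^{tF} F e^{-tF} = 0, with [F] put on the right of the
    first exponential and on the left of the second; the value at 0 is the identity. *)
Lemma mexpN_mul F t : mexp F t *m mexp F (- t) = 1%:M.
Proof.
have E : mexp F 0 *m mexp F (- 0) = 1%:M by rewrite oppr0 mexp0 mulmx1.
rewrite -E; apply/matrixP => i j.
apply: (@cderivative0_cst (fun t => (mexp F t *m mexp F (- t)) i j)).
have dp l := @cderivative_mexpr K F i l; have dn l := cderivativeN_comp (@cderivative_mexp K F l j).
have := cderivativeD (cderivativeM (dp 0) (dn 0)) (cderivativeM (dp 1) (dn 1)).
congr cderivative; apply/funext => x; first by rewrite mulmx2E.
rewrite !mulmx2E /=; ring.
Qed.

Lemma weak_ode a b F (y g : K -> 'cV[K[i]]_2) :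
  (forall i, cintegrable a b (fun x => y x i 0)) ->
  (forall i, cintegrable a b (fun x => g x i 0)) ->
  (forall i, weak_derivative a b (fun x => y x i 0) (fun x => g x i 0)) ->
  g = (fun x => F *m y x) %[ae mu in [set` `]a, b[]] ->
  exists z : 'cV_2, y = (fun x => mexp F (x - a) *m z) %[ae mu in [set` `]a, b[]].
Proof.
(* The integrating factor [N] below satisfies N' = - N F with [F] on the right, so the weak
   derivative N g - N F y of N y vanishes wherever g = F y. *)
move=> yi gi w gF.
pose N x := mexp F (- (x - a)).
have dN i j : cderivative (fun x => N x i j) (fun x => - (N x *m F) i j).
  exact: (cderivative_shift a (cderivativeN_comp (@cderivative_mexpr K F i j))).
have cN i j := cderivative_continuous (dN i j).
have cN' i j : ccontinuous (fun x => - (N x *m F) i j).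
  rewrite (_ : (fun x => _) = fun x => (- F 0 j) * N x i 0 + (- F 1 j) * N x i 1).
    by apply: ccontinuousD; apply: ccontinuousM => //; exact: ccontinuous_cst.
  by apply/funext => x; rewrite mulmx2E; ring.
have zc i : exists m, (fun x => (N x *m y x) i 0) = cst m %[ae mu in [set` `]a, b[]].
  have W l := weak_derivativeM (yi l) (gi l) (dN i l) (cN' i l) (w l).
  have I1 l := cintegrableM (cN i l) (yi l).
  have I2 l := cintegrableD (cintegrableM (cN i l) (gi l)) (cintegrableM (cN' i l) (yi l)).
  have I := cintegrableD (I1 0) (I1 1).
  have WD := weak_derivativeD (I1 0) (I1 1) (I2 0) (I2 1) (W 0) (W 1).
  have [|m Hm] := @weak_derivative0 K a b _ I.
    apply: weak_derivative_ae WD _; first exact: cintegrableD.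
      exact/cintegrable_continuous/ccontinuous_cst.
    apply: ae_mono gF => x h /h e; rewrite e /= !mulmx2E; ring.
  by exists m; apply: ae_mono Hm => x h /h; rewrite mulmx2E.
have [m0 h0] := zc 0; have [m1 h1] := zc 1.
exists (\col_i if i == 0 then m0 else m1).
apply: ae_mono2 h0 h1 => x h0 h1 xab.
rewrite -[y x]mul1mx -(mexpN_mul F (x - a)) -mulmxA; congr (_ *m _).
apply/colP => i; rewrite !mxE.
case: (eqVneq i 0) => [->|i0]; first by have := h0 xab; rewrite mxE.
have -> : i = 1 by apply: val_inj; case: i i0 => [] [|[]].
by have := h1 xab; rewrite mxE.
Qed.

End WeakODE.

(** * Exponential flows and one-sided values *)

Section ContinuousRepresentative.
Variable K : realType.
Local Notation mu := (@lebesgue_measure K).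
Local Notation Re := (@complex.Re K).
Local Notation Im := (@complex.Im K).
Implicit Types (a b x t : K) (u w e g : K -> K[i]) (F : 'M[K[i]]_2).

Definition flow F a (z : 'cV[K[i]]_2) x : 'cV[K[i]]_2 := mexp F (x - a) *m z.

Lemma flow_start F a z : flow F a z a = z.
Proof. by rewrite /flow subrr mexp0 mul1mx. Qed.

Lemma cderivative_flow F a z i :
  cderivative (fun x => flow F a z x i 0) (fun x => (F *m flow F a z x) i 0).
Proof.
have d j := cderivativeM (cderivative_shift a (@cderivative_mexp K F i j))
  (cderivative_cst (z j 0)).
have := cderivativeD (d 0) (d 1).
by congr cderivative; apply/funext => x; rewrite /flow ?mulmxA !mulmx2E //= !mulr0 !addr0.
Qed.

Lemma ccontinuous_flow F a z i : ccontinuous (fun x => flow F a z x i 0).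
Proof. exact: cderivative_continuous (@cderivative_flow F a z i). Qed.

Lemma ccontinuous_flow' F a z i : ccontinuous (fun x => (F *m flow F a z x) i 0).
Proof.
rewrite (_ : (fun x => _) = fun x => F i 0 * flow F a z x 0 0 + F i 1 * flow F a z x 1 0).
  by apply: ccontinuousD; apply: ccontinuousM;
    solve [exact: ccontinuous_cst|exact: ccontinuous_flow].
by apply/funext => x; rewrite mulmx2E.
Qed.

Lemma L2_continuous a b e : ccontinuous e -> L2 `]a, b[ e.
Proof.
move=> [c1 c2].
have cs : ccontinuous (fun x => (Re (e x) ^+ 2 + Im (e x) ^+ 2)%:C).
  apply: ccontinuous_real => x.
  by apply: cvgD; rewrite expr2; apply: cvgM; solve [exact: c1|exact: c2].
split.
- by apply: measurable_funTS; exact: continuous_measurable_fun.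
- by apply: measurable_funTS; exact: continuous_measurable_fun.
- have [+ _] := cintegrable_continuous a b cs.
  by move=> /integrable_lty; apply.
Qed.

Lemma L2_eq (D : set K) u w : {in D, u =1 w} -> L2 D u -> L2 D w.
Proof.
move=> uw [m1 m2 fin]; split.
- by apply: eq_measurable_fun m1 => x /uw ->.
- by apply: eq_measurable_fun m2 => x /uw ->.
- by under eq_integral => x /uw <- do [].
Qed.

Lemma eq_cintegral (D : set K) u w : {in D, u =1 w} -> cintegral D u = cintegral D w.
Proof.
by move=> uw; apply: complexP; apply: eq_Rintegral => x /uw ->.
Qed.

Lemma weak_derivative_eq a b u w g h : {in `]a, b[%classic, u =1 w} ->
  {in `]a, b[%classic, g =1 h} -> weak_derivative a b u g -> weak_derivative a b w h.
Proof.
move=> uw gh W phi t.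
transitivity (cintegral `]a, b[ (fun x => u x * (derive1 phi x)%:C)).
  by apply: eq_cintegral => x /uw ->.
by rewrite W //; congr (- _); apply: eq_cintegral => x /gh ->.
Qed.

(** Otherwise []s, t[] would be negligible, whereas its measure is t - s > 0. *)
Lemma ae_exists a b (P : K -> Prop) s t : {ae mu, forall x, `]a, b[%classic x -> P x} ->
  a <= s -> s < t -> t <= b -> exists2 x, s < x < t & P x.
Proof.
move=> aeP as_ st tb; apply: contrapT => H.
have : mu.-negligible (`]s, t[ : set K).
  apply: negligibleS aeP => x /=; rewrite in_itv /= => /andP[sx xt] h.
  apply: H; exists x; first by rewrite sx.
  by apply: h; rewrite /= in_itv /= (le_lt_trans as_) // (lt_le_trans xt).
move=> /negligibleP => /(_ (measurable_itv _)).
move=> N; have : mu `]s, t[ = 0%E := N.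
rewrite lebesgue_measure_itv /= lte_fin st -EFinD => /eqP.
by rewrite eqe subr_eq0 => /eqP ts; rewrite ts ltxx in st.
Qed.

(** If [f x] were nonzero, [f] would have no zero in [[a, b]] near [x], although its zeros meet
    every nonempty open subinterval. *)
Lemma ae_eq_within a b (f : K -> K) : a < b -> {within `[a, b], continuous f} ->
  f = cst 0 %[ae mu in [set` `]a, b[]] -> {in `[a, b], forall x, f x = 0}.
Proof.
move=> ab /subspace_continuousP cf f0 x xab; apply/eqP; apply: contrapT => /negP fx.
have fx0 : 0 < `|f x| by rewrite normr_gt0.
have /cvgrPdist_lt/(_ _ fx0) := cf x xab.
rewrite near_withinE => /nbhs_ballP[e /= e0 he].
move: (xab); rewrite in_itv /= => /andP[ax xb].
(* The window around [x] is clipped to [[a, b]] because [x] may be an end point; it stays nonempty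
   since a < b. *)
have [|||y /andP[sy yt] fy] := @ae_exists a b (fun y => f y = 0)
  (Num.max a (x - e)) (Num.min b (x + e)) f0.
- by rewrite le_max lexx.
- by rewrite gt_max !lt_min; apply/andP; split; apply/andP; split; lra.
- by rewrite ge_min lexx.
move: sy yt; rewrite gt_max lt_min => /andP[ay ey] /andP[yb ye].
have : `|f x - f y| < `|f x|.
  apply: he; last by rewrite /= in_itv /= !ltW.
  by rewrite /ball /= ltr_norml; apply/andP; split; lra.
by rewrite fy subr0 ltxx.
Qed.

(** The choice made by [xget] has the stated property because [w] has it; two functions continuous
    on [[a, b]] and equal almost everywhere coincide there, end points included. *)
Lemma continuous_repE a b u w : a < b -> ccontinuous w ->
  u = w %[ae mu in [set` `]a, b[]] ->
  {in `[a, b], continuous_rep a b u =1 w}.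
Proof.
move=> ab [c1 c2] uw x xab.
have : {within `[a, b], continuous (continuous_rep a b u : K -> K[i]^o)} /\
    (continuous_rep a b u = u %[ae mu in [set` `]a, b[]]).
  apply: (xgetPex u (P := [set r | {within `[a, b], continuous (r : K -> K[i]^o)} /\
    (r = u %[ae mu in [set` `]a, b[]])])).
  exists w; split; last by apply: ae_mono uw => y h /h.
  apply: continuous_subspaceT => y.
  by apply: complex_cvg; [exact: c1|exact: c2].
move: (continuous_rep a b u) => r [rc ru].
have [r1 r2] : {within `[a, b], continuous (Re \o r)} /\ {within `[a, b], continuous (Im \o r)}.
  by split=> y; have [] := cvg_complex _ (rc y).
apply: complexP; apply/eqP; rewrite -subr_eq0; apply/eqP.
  apply: (@ae_eq_within a b (fun y => Re (r y) - Re (w y))) => //.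
    by move=> y; apply: cvgB; [exact: r1|exact: (continuous_subspaceT c1)].
  by apply: ae_mono2 ru uw => y h1 h2 yab; rewrite h1 // h2 // subrr.
apply: (@ae_eq_within a b (fun y => Im (r y) - Im (w y))) => //.
  by move=> y; apply: cvgB; [exact: r2|exact: (continuous_subspaceT c2)].
by apply: ae_mono2 ru uw => y h1 h2 yab; rewrite h1 // h2 // subrr.
Qed.

End ContinuousRepresentative.

(** * The eigenvalue problem *)

Section Eigenvalue.
Variables (K : realType) (v : nat -> K) (R P : K) (lam : K[i]).
Local Notation mu := (@lebesgue_measure K).
Implicit Types (i : nat) (c q u : K -> K[i]) (z : 'cV[K[i]]_2).

Local Notation node i := (@node K i).

Definition col2 (p r : K[i]) : 'cV[K[i]]_2 := \col_i (if i == 0 then p else r).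

Lemma col2P z (w : 'cV[K[i]]_2) : z 0 0 = w 0 0 -> z 1 0 = w 1 0 -> z = w.
Proof.
move=> e0 e1; apply/colP => k; case: (eqVneq k 0) => [->//|k0].
by have -> : k = 1 by apply: val_inj; case: k k0 => [] [|[]].
Qed.

Lemma mx2_mul (a b c d : K[i]) z :
  mx2 a b c d *m z = col2 (a * z 0 0 + b * z 1 0) (c * z 0 0 + d * z 1 0).
Proof. by apply: col2P; rewrite mulmx2E !mxE. Qed.

Lemma nodeS i : node i.+1 = node i + 1.
Proof. by rewrite /Defs.node -[i.+1%:R]natr1 addrA. Qed.

Lemma node_lt i : node i < node i.+1.
Proof. by rewrite nodeS ltrDl. Qed.

(** The open intervals are pairwise disjoint, so the sum reduces to its term [i]. *)
Lemma piecewiseE (f : nat -> K -> K[i]) i x : (1 <= i <= 4)%N ->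
  x \in `]node i, node i.+1[ -> piecewise f x = f i x.
Proof.
move=> i14 xi; rewrite /piecewise (eq_bigl (pred1 i)); last first.
  have lt j k y : (j < k)%N -> y \in `]node j, node j.+1[ -> y \notin `]node k, node k.+1[.
    move=> jk; rewrite !in_itv /= => /andP[_ yj]; rewrite negb_and -leNgt.
    by rewrite (le_trans (ltW yj)) // lerD2l ler_nat.
  move=> j /=; case: (ltngtP j i) => [ji|ij|->//].
    by apply/negbTE; apply: contraL xi => /(lt _ _ _ ji).
  by apply/negbTE; exact: lt xi.
by rewrite big_nat1_eq ltnS i14.
Qed.

Lemma ae_neq (r : K) : {ae mu, forall x, x != r}.
Proof.
exists [set r]; split => //; first exact: lebesgue_measure_set1.
by move=> x /= /negP; rewrite negbK => /eqP.
Qed.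

(** The four intervals miss only the points -1, 0 and 1, a null set. *)
Lemma ae_intervals (Q : K -> Prop) :
  (forall i, (1 <= i <= 4)%N -> {ae mu, forall x, `]node i, node i.+1[%classic x -> Q x}) ->
  {ae mu, forall x, `](- 2), 2[%classic x -> Q x}.
Proof.
move=> H; have := ae_mono2 _ (H 1%N isT) (H 2%N isT); move=> /(_ _ (fun x h1 h2 => conj h1 h2)).
have := ae_mono2 _ (H 3%N isT) (H 4%N isT); move=> /(_ _ (fun x h1 h2 => conj h1 h2)).
have := ae_mono2 _ (ae_neq (-1)) (ae_neq 0); move=> /(_ _ (fun x h1 h2 => conj h1 h2)).
have := ae_neq 1.
move=> n3 n12 h34 h12; apply: ae_mono2 (ae_mono2 _ n3 n12) (ae_mono2 _ h34 h12).
- 2: by move=> x a b; exact: (conj a b).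
- 2: by move=> x a b; exact: (conj a b).
move=> x [n3' [n1' n2']] [[h3' h4'] [h1' h2']] /=; rewrite in_itv /= => /andP[x2 x2'].
have [] : [\/ x \in `]node 1, node 2[, x \in `]node 2, node 3[, x \in `]node 3, node 4[
   | x \in `]node 4, node 5[].
  rewrite !in_itv /= /Defs.node.
  (* Of the eight sign patterns left, the leftmost node lying to the right of [x] decides the
     interval; contradictory patterns do no harm. *)
  case: (ltgtP x (-1)) n1' => // ?; case: (ltgtP x 0) n2' => // ?;
  case: (ltgtP x 1) n3' => // ? _ _ _;
  [apply: Or41|apply: Or41|apply: Or41|apply: Or41|apply: Or42
    |apply: Or42|apply: Or43|apply: Or44]; lra.
- exact: h1'.
- exact: h2'.
- exact: h3'.
- exact: h4'.
Qed.

Lemma subset_interval i : (1 <= i <= 4)%N -> `]node i, node i.+1[ `<=` (`](- 2), 2[ : set K).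
Proof.
move=> /andP[i1 i4] x /=; rewrite !in_itv /= /Defs.node => /andP[xi xi'].
have : (1 : K) <= i%:R by rewrite ler1n.
have : i%:R <= (4 : K) by rewrite ler_nat.
by move: xi xi'; rewrite -[i.+1%:R]natr1 => *; apply/andP; split; lra.
Qed.

(** This is where F_i comes from: the eigenvalue equation solved for the derivatives [dc] and [dq],
    the first row after division by - v_i. *)
Lemma eigen_pointwise i (c q dc dq : K[i]) : 0 < v i ->
  (- (v i)%:C * dc - (R * P ^+ 2)%:C * c + (R * P)%:C * q = lam * c /\
   dq + (R * P)%:C * c - R%:C * q = lam * q) <->
  col2 dc dq = Fmx v R P i lam *m col2 c q.
Proof.
move=> vi; have vC : (v i)%:C != 0 :> K[i] by rewrite eq_complex /= eqxx andbT gt_eqF.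
rewrite /Fmx mx2_mul !mxE /= fmorph_div !rmorphM /=.
move: (v i)%:C (R%:C) (P%:C) vC => V A B vC; split.
  move=> [e1 e2]; apply: col2P; rewrite !mxE /=.
    apply: (mulfI vC); transitivity (- (lam * c) - A * B ^+ 2 * c + A * B * q).
      by rewrite -e1; ring.
    by field; rewrite vC.
  by rewrite mulrDl -e2; ring.
move=> e; have e1 := congr1 (fun M : 'cV[K[i]]_2 => M 0 0) e.
have e2 := congr1 (fun M : 'cV[K[i]]_2 => M 1 0) e; rewrite !mxE /= in e1 e2.
split; last by rewrite e2; ring.
by rewrite e1; field; rewrite vC.
Qed.

Lemma H1_wderiv a b u : H1 a b u -> L2 `]a, b[ u /\
  (L2 `]a, b[ (wderiv a b u) /\ weak_derivative a b u (wderiv a b u)).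
Proof.
move=> [u2 [g g2 wg]]; split=> //.
by apply: (xgetPex (cst 0) (P := [set g | L2 `]a, b[ g /\ weak_derivative a b u g])); exists g.
Qed.

Lemma interval_solution i c q : (1 <= i <= 4)%N -> 0 < v i ->
  H1 (node i) (node i.+1) c -> H1 (node i) (node i.+1) q ->
  eqL2xL2 (- 2) 2 (opA v R P (c, q)) (fun x => lam * c x, fun x => lam * q x) ->
  exists z, (fun x => col2 (c x) (q x)) = flow (Fmx v R P i lam) (node i) z
    %[ae mu in [set` `]node i, node i.+1[]].
Proof.
move=> i14 vi /H1_wderiv[c2 [dc2 wc]] /H1_wderiv[q2 [dq2 wq]] [e1 e2].
apply: (@weak_ode K _ _ _ _ (fun x => col2 (wderiv (node i) (node i.+1) c x)
   (wderiv (node i) (node i.+1) q x))).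
- move=> k; rewrite (_ : (fun x => _) = if k == 0 then c else q).
    by case: ifP => _; exact: cintegrable_L2.
  by apply/funext => x; rewrite mxE; case: ifP.
- move=> k; rewrite (_ : (fun x => _) = if k == 0 then wderiv (node i) (node i.+1) c else
    wderiv (node i) (node i.+1) q).
    by case: ifP => _; exact: cintegrable_L2.
  by apply/funext => x; rewrite mxE; case: ifP.
- move=> k; rewrite (_ : (fun x => _) = if k == 0 then c else q); last first.
    by apply/funext => x; rewrite mxE; case: ifP.
  rewrite (_ : (fun x => col2 _ _ k 0) = if k == 0 then wderiv (node i) (node i.+1) c else
    wderiv (node i) (node i.+1) q).
    by case: ifP.
  by apply/funext => x; rewrite mxE; case: ifP.
apply: ae_mono2 e1 e2 => x e1 e2 xi; apply/eigen_pointwise => //.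
move: (e1 (subset_interval i14 xi)) (e2 (subset_interval i14 xi)).
by rewrite /= !(piecewiseE _ i14 xi).
Qed.

Lemma left_value_flow i F z u k :
  u = (fun x => flow F (node i) z x k 0) %[ae mu in [set` `]node i, node i.+1[]] ->
  left_value i u = z k 0.
Proof.
move=> uf; rewrite /left_value (continuous_repE (node_lt i) (ccontinuous_flow _ _ _ _) uf).
  by rewrite flow_start.
by rewrite in_itv /= lexx ltW // node_lt.
Qed.

(** Each interval has length 1, so the flow reaches its right end at time 1. *)
Lemma right_value_flow i F z u k :
  u = (fun x => flow F (node i) z x k 0) %[ae mu in [set` `]node i, node i.+1[]] ->
  right_value i u = (expmx F *m z) k 0.
Proof.
move=> uf; rewrite /right_value (continuous_repE (node_lt i) (ccontinuous_flow _ _ _ _) uf) //.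
  by rewrite /flow nodeS addrC addKr expmxE.
by rewrite in_itv /= lexx andbT ltW // node_lt.
Qed.

Lemma det_mx2 (M : 'M[K[i]]_2) : \det M = M 0 0 * M 1 1 - M 0 1 * M 1 0.
Proof.
rewrite (expand_det_row _ 0) sum_ord2 /cofactor !det_mx11 !mxE /=.
have -> : lift 0 0 = 1 :> 'I_2 by exact: val_inj.
have -> : lift 1 0 = 0 :> 'I_2 by exact: val_inj.
by rewrite /bump /= expr0 expr1; ring.
Qed.

Lemma det_sub1 (M : 'M[K[i]]_2) : - \det (M - 1%:M) = \tr M - \det M - 1.
Proof. rewrite !det_mx2 /mxtrace sum_ord2 !mxE /=; ring. Qed.

(** [eigenvalue] speaks of row vectors, whereas the transmission conditions produce column vectors;
    the determinant is the common ground with [fixed_vector_det]. *)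
Lemma eigenvalue1_det (M : 'M[K[i]]_2) : eigenvalue M 1 <-> \det (M - 1%:M) = 0.
Proof.
rewrite /eigenvalue /eigenspace kermx_eq0 row_free_unit unitmxE unitfE negbK.
by split=> /eqP.
Qed.

Lemma fixed_vector_det (M : 'M[K[i]]_2) :
  (exists2 z : 'cV[K[i]]_2, z != 0 & M *m z = z) <-> \det (M - 1%:M) = 0.
Proof.
rewrite -det_tr; split.
  move=> [z z0 Mz]; apply/eqP/det0P; exists z^T; first by rewrite trmx_eq0.
  by rewrite -trmx_mul mulmxBl mul1mx Mz subrr trmx0.
move/eqP/det0P => [w w0 wM]; exists w^T; first by rewrite trmx_eq0.
apply/eqP; rewrite -subr_eq0 -{2}[w^T]mul1mx -mulmxBl; apply/eqP/trmx_inj.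
by rewrite trmx_mul trmxK wM trmx0.
Qed.

End Eigenvalue.

(** * Eigenfunctions versus fixed vectors of C(lambda) *)

Section Main.
Variables (K : realType) (v : nat -> K) (R P : K) (lam : K[i]).
Hypotheses (v1_gt0 : 0 < v 1%N) (v2_gt0 : 0 < v 2%N) (v3_gt0 : 0 < v 3%N) (v4_gt0 : 0 < v 4%N).
Local Notation mu := (@lebesgue_measure K).
Local Notation node i := (@node K i).
Local Notation F i := (Fmx v R P i lam).

Lemma velocity_gt0 i : (1 <= i <= 4)%N -> 0 < v i.
Proof. by case: i => [|[|[|[|[|]]]]]. Qed.

(** Read from the right, C(lambda) carries the value [z] at -1^+ across I_2, over the jump at 0,
    across I_3 and I_4, over the jump from 2 to -2, and across I_1 back to -1. The vectors [z1],
    [z3], [z4] are the values at the left ends of I_1, I_3, I_4. *)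
Lemma fixed_vector_chain (E1 D E4 E3 D' E2 : 'M[K[i]]_2) (z : 'cV[K[i]]_2) :
  E1 *m D *m E4 *m E3 *m D' *m E2 *m z = z <->
  exists z1 z3 z4 : 'cV_2,
    [/\ z = E1 *m z1, z3 = D' *m (E2 *m z), z4 = E3 *m z3 & z1 = D *m (E4 *m z4)].
Proof.
rewrite -!mulmxA; split; last by move=> [z1 [z3 [z4 [e2 e3 e4 e1]]]]; rewrite -e3 -e4 -e1 -e2.
move=> Cz; exists (D *m (E4 *m (E3 *m (D' *m (E2 *m z))))).
by exists (D' *m (E2 *m z)), (E3 *m (D' *m (E2 *m z))).
Qed.

(** Used for both jumps: [p / r] is v_4 / v_1 where 2 meets -2 and v_2 / v_3 at 0; the second
    component is q, which does not jump. *)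
Lemma jump_mx2 (p r : K) (z w : 'cV[K[i]]_2) : 0 < r ->
  z = mx2 (p / r)%:C 0 0 1 *m w <-> r%:C * z 0 0 = p%:C * w 0 0 /\ z 1 0 = w 1 0.
Proof.
move=> r0; have rC : r%:C != 0 :> K[i] by rewrite eq_complex /= eqxx andbT gt_eqF.
rewrite mx2_mul !mul0r mul1r addr0 add0r fmorph_div; split.
  by move=> ->; rewrite !mxE /=; split=> //; field; rewrite rC.
move=> [e0 e1]; apply: col2P; rewrite !mxE //=.
by apply: (mulfI rC); rewrite e0; field; rewrite rC.
Qed.

Lemma eigenvalueA_fixed_vector :
  eigenvalueA v R P lam -> exists2 z : 'cV_2, z != 0 & Cmx v R P lam *m z = z.
Proof.
move=> [[c q] [[H1cq [c12 c34 c41 c23] [q12 q23 q34 q41]] nz Au]].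
have sol i : (1 <= i <= 4)%N -> exists z,
    [/\ (fun x => col2 (c x) (q x)) = flow (F i) (node i) z
          %[ae mu in [set` `]node i, node i.+1[]],
      left_value i c = z 0 0, left_value i q = z 1 0,
      right_value i c = (expmx (F i) *m z) 0 0 & right_value i q = (expmx (F i) *m z) 1 0].
  move=> i14; have [H1c H1q] := H1cq i i14.
  have [z zE] := interval_solution i14 (velocity_gt0 i14) H1c H1q Au.
  have ck : c = (fun x => flow (F i) (node i) z x 0 0) %[ae mu in [set` `]node i, node i.+1[]].
    by apply: ae_mono zE => x h /h <-; rewrite mxE.
  have qk : q = (fun x => flow (F i) (node i) z x 1 0) %[ae mu in [set` `]node i, node i.+1[]].
    by apply: ae_mono zE => x h /h <-; rewrite mxE.
  by exists z; split=> //; [exact: left_value_flow ck|exact: left_value_flow qk|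
    exact: right_value_flow ck|exact: right_value_flow qk].
have [z1 [s1 l1c l1q r1c r1q]] := sol 1%N isT.
have [z2 [s2 l2c l2q r2c r2q]] := sol 2%N isT.
have [z3 [s3 l3c l3q r3c r3q]] := sol 3%N isT.
have [z4 [s4 l4c l4q r4c r4q]] := sol 4%N isT.
have e2 : z2 = expmx (F 1) *m z1.
  by apply: col2P; rewrite -?l2c -?l2q -?r1c -?r1q.
have e4 : z4 = expmx (F 3) *m z3.
  by apply: col2P; rewrite -?l4c -?l4q -?r3c -?r3q.
have e1 : z1 = mx2 (v 4%N / v 1%N)%:C 0 0 1 *m (expmx (F 4) *m z4).
  by apply/jump_mx2 => //; rewrite -l1c -l1q -r4c -r4q.
have e3 : z3 = mx2 (v 2%N / v 3%N)%:C 0 0 1 *m (expmx (F 2) *m z2).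
  by apply/jump_mx2 => //; rewrite -l3c -l3q -r2c -r2q.
exists z2; last by apply/fixed_vector_chain; exists z1, z3, z4.
apply/eqP => z20; apply: nz.
have z30 : z3 = 0 by rewrite e3 z20 !mulmx0.
have z40 : z4 = 0 by rewrite e4 z30 mulmx0.
have z10 : z1 = 0 by rewrite e1 z40 !mulmx0.
have u0 : {ae mu, forall x, `](- 2), 2[%classic x -> col2 (c x) (q x) = 0}.
  apply: ae_intervals; case=> [|[|[|[|[|]]]]] // _.
  - by apply: ae_mono s1 => x h /h ->; rewrite z10 /flow mulmx0.
  - by apply: ae_mono s2 => x h /h ->; rewrite z20 /flow mulmx0.
  - by apply: ae_mono s3 => x h /h ->; rewrite z30 /flow mulmx0.
  - by apply: ae_mono s4 => x h /h ->; rewrite z40 /flow mulmx0.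
split.
  by apply: ae_mono u0 => x h /h /(congr1 (fun z : 'cV_2 => z 0 0)); rewrite !mxE.
by apply: ae_mono u0 => x h /h /(congr1 (fun z : 'cV_2 => z 1 0)); rewrite !mxE.
Qed.

Lemma fixed_vector_eigenvalueA (z : 'cV[K[i]]_2) :
  z != 0 -> Cmx v R P lam *m z = z -> eigenvalueA v R P lam.
Proof.
move=> z0 /fixed_vector_chain[z1 [z3 [z4 [ez z3E z4E z1E]]]].
(* [Z i] is the initial value on I_i; entry 0 is a filler since the intervals are numbered from 1,
   and the list has [z] itself on I_2. *)
pose Z := nth z [:: z; z1; z; z3; z4].
pose y k := piecewise (fun i x => flow (F i) (node i) (Z i) x k 0).
have yE k i : (1 <= i <= 4)%N ->
    {in `]node i, node i.+1[%classic, y k =1 (fun x => flow (F i) (node i) (Z i) x k 0)}.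
  by move=> i14 x; rewrite inE => xi; exact: piecewiseE.
have yae k i : (1 <= i <= 4)%N ->
    y k = (fun x => flow (F i) (node i) (Z i) x k 0) %[ae mu in [set` `]node i, node i.+1[]].
  by move=> i14; apply: aeW => x xi; apply: yE => //; rewrite inE.
have yW k i : (1 <= i <= 4)%N -> weak_derivative (node i) (node i.+1) (y k)
    (fun x => (F i *m flow (F i) (node i) (Z i) x) k 0).
  move=> i14; have := @weak_derivative_C1 K (node i) (node i.+1) _ _
    (@cderivative_flow K (F i) (node i) (Z i) k) (@ccontinuous_flow' K _ _ _ _).
  by apply: weak_derivative_eq => x // /(yE k i i14) ->.
have yL k i : (1 <= i <= 4)%N -> L2 `]node i, node i.+1[ (y k).
  move=> i14; apply: (L2_eq (u := fun x => flow (F i) (node i) (Z i) x k 0)).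
    by move=> x /(yE k i i14) ->.
  exact/L2_continuous/ccontinuous_flow.
have yH k i : (1 <= i <= 4)%N -> H1 (node i) (node i.+1) (y k).
  move=> i14; split; first exact: yL.
  exists (fun x => (F i *m flow (F i) (node i) (Z i) x) k 0); last exact: yW.
  exact/L2_continuous/ccontinuous_flow'.
have lv k i (i14 : (1 <= i <= 4)%N) := left_value_flow (yae k i i14).
have rv k i (i14 : (1 <= i <= 4)%N) := right_value_flow (yae k i i14).
have l1 k : left_value 1 (y k) = z1 k 0 by exact: (lv k 1%N isT).
have l2 k : left_value 2 (y k) = z k 0 by exact: (lv k 2%N isT).
have l3 k : left_value 3 (y k) = z3 k 0 by exact: (lv k 3%N isT).
have l4 k : left_value 4 (y k) = z4 k 0 by exact: (lv k 4%N isT).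
have r1 k : right_value 1 (y k) = z k 0 by rewrite [in RHS]ez; exact: (rv k 1%N isT).
have r3 k : right_value 3 (y k) = z4 k 0 by rewrite [in RHS]z4E; exact: (rv k 3%N isT).
have [j10 j11] := (jump_mx2 _ _ _ v1_gt0).1 z1E; rewrite -2!(rv _ 4%N isT) in j10 j11.
have [j30 j31] := (jump_mx2 _ _ _ v3_gt0).1 z3E; rewrite -2!(rv _ 2%N isT) in j30 j31.
exists (y 0, y 1); split.
- split.
  + by move=> i i14; split; exact: yH.
  + by split; rewrite ?r1 ?r3 ?l2 ?l4 ?l1 ?l3.
  + by split; rewrite ?r1 ?r3 ?l2 ?l4 ?l1 ?l3.
(* If the candidate vanished almost everywhere, the zero function would be its continuous
   representative on I_2, and its value [z] at -1^+ would be 0. *)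
- move=> [c0 q0]; case/eqP: z0; apply: col2P; rewrite mxE.
  + rewrite -l2 /left_value (@continuous_repE _ _ _ _ (cst 0)) //.
    * exact: node_lt.
    * exact: ccontinuous_cst.
    * by apply: ae_mono c0 => x h /(@subset_interval K 2%N isT) /h.
    * by rewrite in_itv /= lexx ltW // node_lt.
  + rewrite -l2 /left_value (@continuous_repE _ _ _ _ (cst 0)) //.
    * exact: node_lt.
    * exact: ccontinuous_cst.
    * by apply: ae_mono q0 => x h /(@subset_interval K 2%N isT) /h.
    * by rewrite in_itv /= lexx ltW // node_lt.
have yw k i : (1 <= i <= 4)%N -> wderiv (node i) (node i.+1) (y k) =
    (fun x => (F i *m flow (F i) (node i) (Z i) x) k 0) %[ae mu in [set` `]node i, node i.+1[]].
  move=> i14; have [_ [wL wW]] := H1_wderiv (yH k i i14).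
  apply: weak_derivative_unique wW (yW k i i14); first exact: cintegrable_L2.
  exact/cintegrable_continuous/ccontinuous_flow'.
have eqs i : (1 <= i <= 4)%N -> {ae mu, forall x, `]node i, node i.+1[%classic x ->
    (opA v R P (y 0, y 1)).1 x = lam * y 0 x /\ (opA v R P (y 0, y 1)).2 x = lam * y 1 x}.
  move=> i14; apply: ae_mono2 (yw 0 i i14) (yw 1 i i14) => x w0 w1 xi.
  rewrite /= !(piecewiseE _ i14 xi); apply/eigen_pointwise; first exact: velocity_gt0.
  rewrite (w0 xi) (w1 xi) !(yE _ i i14) ?inE //.
  have E (w : 'cV[K[i]]_2) : col2 (w 0 0) (w 1 0) = w by apply: col2P; rewrite mxE.
  by rewrite !E.
have eqsD := ae_intervals eqs.
by split; [apply: ae_mono eqsD => x h /h []|apply: ae_mono eqsD => x h /h []].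
Qed.

End Main.

Theorem mainTheorem2 (K : realType) (R P : K) (v : nat -> K)
  (R_gt0 : 0 < R) (P_gt0 : 0 < P)
  (v1_gt0 : 0 < v 1%N) (v2_gt0 : 0 < v 2%N)
  (v3_gt0 : 0 < v 3%N) (v4_gt0 : 0 < v 4%N)
  (v12 : v 1%N > v 2%N) (v23 : v 2%N < v 3%N) (v34 : v 3%N > v 4%N) (v41 : v 4%N < v 1%N)
  (lam : K[i]) :
  [/\ Delta v R P lam = \tr (Cmx v R P lam) - \det (Cmx v R P lam) - 1,
      eigenvalueA v R P lam <-> eigenvalue (Cmx v R P lam) 1 &
      eigenvalueA v R P lam <-> Delta v R P lam = 0].
Proof.
have A_det : eigenvalueA v R P lam <-> \det (Cmx v R P lam - 1%:M) = 0.
  rewrite -fixed_vector_det; split; first exact: eigenvalueA_fixed_vector.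
  by move=> [z z0 Cz]; apply: (fixed_vector_eigenvalueA _ _ _ _ z0 Cz).
split; first exact: det_sub1.
- by rewrite A_det eigenvalue1_det.
- by rewrite A_det /Delta; split=> [->|/eqP]; rewrite ?oppr0 ?oppr_eq0 // => /eqP.
Qed.
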